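(* There exists an oracle $A \subseteq \{0,1\}^*$ such that $\mathrm{NP}^A = \mathrm{PSPACE}^A$ and $\mathrm{UP}^A$ has no $\leq_\mathrm{m}^{\mathrm{p},A}$-complete set; that is, there is no set $C \in \mathrm{UP}^A$ such that $L \leq_\mathrm{m}^{\mathrm{p},A} C$ holds for every $L \in \mathrm{UP}^A$.
   Context: All languages are over $\Sigma = \{0,1\}$. Oracle Turing machines have a write-only oracle tape; complexity classes and reductions are relativized by giving all machines access to the oracle $A$. $\mathrm{UP}^A$ is the class of languages accepted by polynomial-time nondeterministic oracle machines with oracle $A$ that have at most one accepting path on every input. $L \leq_\mathrm{m}^{\mathrm{p},A} C$ means there is a function $f$ computable in polynomial time with oracle $A$ such that $x \in L \Leftrightarrow f(x) \in C$ for all $x$. *)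

(* Defs.v *)
From Stdlib Require Import List Arith.
Import ListNotations.

Definition word := list bool.
Definition language := word -> Prop.

(* Tape symbols: a blank (None) or a bit. *)
Definition sym := option bool.

Inductive move := MoveL | MoveR | Stay.

(* A transition (q, a, q', b, d, o): in state q reading a on the work tape,
   go to state q', write b, move the work head by d, and append o (if Some)
   to the write-only oracle tape. *)
Definition transition : Type := (nat * sym * nat * sym * move * option bool)%type.

(* An oracle Turing machine: one work tape (initially holding the input)
   and a write-only oracle tape.  States are natural numbers; the finitely
   many transitions are listed.  The query state asks whether the current
   oracle-tape content is in the oracle, moves to q_yes / q_no accordingly
   and erases the oracle tape.  The machine halts in q_acc (accepting);
   a configuration with no applicable transition is a rejecting halt. *)
Record OTM := {
  trans : list transition;
  q_start : nat;
  q_acc : nat;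
  q_query : nat;
  q_yes : nat;
  q_no : nat
}.

Record config := {
  c_state : nat;
  c_left : list sym;   (* cells left of the head, nearest first *)
  c_right : list sym;  (* cell under the head followed by cells to the right *)
  c_oracle : list bool
}.

Definition init (M : OTM) (x : word) : config :=
  {| c_state := q_start M; c_left := []; c_right := map Some x; c_oracle := [] |}.

Definition head_sym (c : config) : sym :=
  match c_right c with [] => None | a :: _ => a end.

Definition move_tape (l r : list sym) (b : sym) (d : move) : list sym * list sym :=
  let r' := b :: tl r in
  match d with
  | Stay => (l, r')
  | MoveR => (b :: l, tl r)
  | MoveL => match l with [] => ([], r') | a :: l' => (l', a :: r') end
  end.

Definition apply_trans (c : config) (t : transition) : config :=
  match t with
  | (_, _, q', b, d, o) =>
    let lr := move_tape (c_left c) (c_right c) b d in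
    {| c_state := q';
       c_left := fst lr;
       c_right := snd lr;
       c_oracle := match o with None => c_oracle c | Some bit => c_oracle c ++ [bit] end |}
  end.

Definition trans_src (t : transition) : nat * sym :=
  match t with (q, a, _, _, _, _) => (q, a) end.

Inductive step (A : language) (M : OTM) : config -> config -> Prop :=
  | step_trans : forall c t,
      c_state c <> q_acc M -> c_state c <> q_query M ->
      In t (trans M) -> trans_src t = (c_state c, head_sym c) ->
      step A M c (apply_trans c t)
  | step_query_yes : forall c,
      c_state c <> q_acc M -> c_state c = q_query M -> A (c_oracle c) ->
      step A M c {| c_state := q_yes M; c_left := c_left c;
                    c_right := c_right c; c_oracle := [] |}
  | step_query_no : forall c,
      c_state c <> q_acc M -> c_state c = q_query M -> ~ A (c_oracle c) ->
      step A M c {| c_state := q_no M; c_left := c_left c;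
                    c_right := c_right c; c_oracle := [] |}.

Fixpoint chain (A : language) (M : OTM) (c : config) (cs : list config) : Prop :=
  match cs with
  | [] => True
  | c' :: cs' => step A M c c' /\ chain A M c' cs'
  end.

Definition acc_path (A : language) (M : OTM) (x : word) (cs : list config) : Prop :=
  chain A M (init M x) cs /\ c_state (last cs (init M x)) = q_acc M.

Definition accepts (A : language) (M : OTM) (x : word) : Prop :=
  exists cs, acc_path A M x cs.

Definition reachable (A : language) (M : OTM) (x : word) (c : config) : Prop :=
  exists cs, chain A M (init M x) cs /\ last cs (init M x) = c.

Definition poly_bounded (f : nat -> nat) : Prop :=
  exists k, forall n, f n <= n ^ k + k.

Definition time_bounded (A : language) (M : OTM) (p : nat -> nat) : Prop :=
  forall x cs, chain A M (init M x) cs -> length cs <= p (length x).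

Definition space (c : config) : nat :=
  length (c_left c) + length (c_right c) + length (c_oracle c).

Definition space_bounded (A : language) (M : OTM) (p : nat -> nat) : Prop :=
  forall x c, reachable A M x c -> space c <= p (length x).

Definition deterministic (M : OTM) : Prop :=
  forall t1 t2, In t1 (trans M) -> In t2 (trans M) ->
    trans_src t1 = trans_src t2 -> t1 = t2.

Fixpoint read_word (r : list sym) : word :=
  match r with
  | Some b :: r' => b :: read_word r'
  | _ => []
  end.

Definition output (c : config) : word := read_word (c_right c).

Definition NP (A : language) (L : language) : Prop :=
  exists M p, poly_bounded p /\ time_bounded A M p /\
    forall x, L x <-> accepts A M x.

Definition UP (A : language) (L : language) : Prop :=
  exists M p, poly_bounded p /\ time_bounded A M p /\
    (forall x cs1 cs2, acc_path A M x cs1 -> acc_path A M x cs2 -> cs1 = cs2) /\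
    forall x, L x <-> accepts A M x.

Definition PSPACE (A : language) (L : language) : Prop :=
  exists M p, deterministic M /\ poly_bounded p /\ space_bounded A M p /\
    forall x, L x <-> accepts A M x.

Definition FP (A : language) (f : word -> word) : Prop :=
  exists M p, deterministic M /\ poly_bounded p /\ time_bounded A M p /\
    forall x, exists c, reachable A M x c /\ c_state c = q_acc M /\ output c = f x.

Definition mreduces (A : language) (L C : language) : Prop :=
  exists f, FP A f /\ forall x, L x <-> C (f x).

(* Main.v *)
Require Import Defs.
From Stdlib Require Import List Arith Lia Classical ClassicalEpsilon Cantor.
Import ListNotations.

(** The oracle contains, for every machine [M], exponent [k] and input [x], a claim "[M]
    accepts [x] in space [s]" that is true iff some witness [z] of length [s] is attached to
    it in the oracle.  Claims are longer than the space they speak about, so truth is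
    well-founded, and a single existential search over [z] decides every NP and every PSPACE
    language: this gives NP = PSPACE.  The set of witnesses of a true claim is arbitrary
    except that it is nonempty, and this freedom defeats UP.

    Given [N], a candidate reduction [F] and a large [n], let [S] be a set of words of length
    [n] attached to [N] in the oracle; [0^n] is in the diagonal language of [N] iff [S] is
    nonempty.  A certificate is an accepting run of [N] on the output of [F], with its positive
    and negative queries.  Suppose that distinct certificates never coexist in a valid oracle
    (else [N] is ambiguous) and that certificates exist exactly when [S] is nonempty, for [S]
    with at most one element (else [F] is not a reduction).  From the longest claims downwards,
    one eliminates the claims asserted by certificates: as long as the oracle below length [l]
    is fixed, the truth values of the claims of length [l] are fixed as well, so two
    certificates can only conflict by one asserting a witness that the other one denies, and
    choosing the witnesses freshly makes some certificate deny more than it can query.  What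
    remains are certificates asserting only the element of [S], and the same argument applied
    to [S] itself is contradictory. *)

(** * Oracles that agree on short words, and runs in bounded space *)

Definition agree (n : nat) (A B : language) : Prop :=
  forall w, length w < n -> (A w <-> B w).

Lemma agree_sym n A B : agree n A B -> agree n B A.
Proof. intros H w Hw; symmetry; auto. Qed.

Lemma agree_trans n A B C : agree n A B -> agree n B C -> agree n A C.
Proof. intros H1 H2 w Hw; rewrite (H1 w Hw); auto. Qed.

Lemma agree_le m n A B : m <= n -> agree n A B -> agree m A B.
Proof. intros Hmn H w Hw; apply H; lia. Qed.

Lemma last_cons {T} (a d : T) l : last (a :: l) d = last l a.
Proof.
  revert a d; induction l as [|b l IH]; intros a d; [reflexivity|].
  change (last (b :: l) d = last (b :: l) a); now rewrite !IH.
Qed.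

Lemma chain_app A M c cs1 cs2 :
  chain A M c (cs1 ++ cs2) <-> chain A M c cs1 /\ chain A M (last cs1 c) cs2.
Proof.
  revert c; induction cs1 as [|c1 cs1 IH]; intros c.
  - simpl; tauto.
  - rewrite last_cons; cbn [app chain]; rewrite IH; tauto.
Qed.

Lemma length_tl {T} (l : list T) : length (tl l) = length l - 1.
Proof. destruct l; simpl; lia. Qed.

(** One step creates at most one work-tape cell and at most one oracle-tape bit. *)
Lemma step_space A M c c' : step A M c c' -> space c' <= space c + 2.
Proof.
  intros H; destruct H as [c t _ _ _ _| |]; unfold space; [|simpl; lia..].
  destruct t as [[[[[q a] q'] b] d] o]; destruct c as [st l r w]; simpl.
  assert (Ho : length (match o with Some bit => w ++ [bit] | None => w end) <= length w + 1)
    by (destruct o; rewrite ?length_app; simpl; lia).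
  destruct d; [destruct l| |]; simpl; rewrite length_tl; lia.
Qed.

Lemma step_oracle A M c c' :
  step A M c c' -> length (c_oracle c') <= length (c_oracle c) + 1.
Proof.
  intros H; destruct H as [c t _ _ _ _| |]; [|simpl; lia..].
  destruct t as [[[[[q a] q'] b] d] o]; simpl.
  destruct o; rewrite ?length_app; simpl; lia.
Qed.

Lemma chain_space A M c cs :
  chain A M c cs -> space (last cs c) <= space c + 2 * length cs.
Proof.
  revert c; induction cs as [|c1 cs IH]; intros c; [simpl; lia|].
  intros [H1 H2]; rewrite last_cons; cbn [length].
  apply step_space in H1; apply IH in H2; lia.
Qed.

Lemma step_agree n A B M c c' :
  agree n A B -> length (c_oracle c) < n -> step A M c c' -> step B M c c'.
Proof.
  intros HAB Hn H; destruct H.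
  - now apply step_trans.
  - apply step_query_yes; auto; now apply HAB.
  - apply step_query_no; auto; now rewrite <- (HAB (c_oracle c)).
Qed.

Lemma step_not_acc A M c c' : step A M c c' -> c_state c <> q_acc M.
Proof. now destruct 1. Qed.

Definition accepts_in_space (A : language) (M : OTM) (x : word) (s : nat) : Prop :=
  exists cs, acc_path A M x cs /\ forall c, In c (init M x :: cs) -> space c <= s.

Lemma chain_agree_space s A B M c cs :
  agree (S s) A B -> (forall d, In d (c :: cs) -> space d <= s) ->
  chain A M c cs -> chain B M c cs.
Proof.
  intros HAB; revert c; induction cs as [|c1 cs IH]; intros c Hs; [trivial|].
  intros [H1 H2]; split.
  - apply (step_agree (S s) A); trivial.
    specialize (Hs c (or_introl eq_refl)); unfold space in Hs; lia.
  - apply IH; trivial; intros d Hd; apply Hs; now right.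
Qed.

(** [space] counts the oracle tape, so such a run queries only words of length at most [s]. Since a
    fact word is longer than its witness, the truth of a claim depends only on shorter oracle
    words. *)
Lemma accepts_in_space_agree s A B M x :
  agree (S s) A B -> accepts_in_space A M x s -> accepts_in_space B M x s.
Proof.
  intros HAB [cs [[H1 H2] H3]]; exists cs; repeat split; trivial.
  now apply (chain_agree_space s A).
Qed.

(** * Queries of a run *)

(* When [q_yes M = q_no M] the answer leaves no trace in the run and is not recorded. *)
Fixpoint pos_queries (M : OTM) (c : config) (cs : list config) : list word :=
  match cs with
  | [] => []
  | c' :: cs' =>
    (if ((c_state c =? q_query M) && (c_state c' =? q_yes M) && negb (q_yes M =? q_no M))%bool
     then [c_oracle c] else []) ++ pos_queries M c' cs'
  end.

Fixpoint neg_queries (M : OTM) (c : config) (cs : list config) : list word :=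
  match cs with
  | [] => []
  | c' :: cs' =>
    (if ((c_state c =? q_query M) && (c_state c' =? q_no M) && negb (q_yes M =? q_no M))%bool
     then [c_oracle c] else []) ++ neg_queries M c' cs'
  end.

(** A step contributes to only one of the two lists, because nothing is recorded when
    [q_yes M = q_no M]. *)
Lemma queries_count M c cs :
  length (pos_queries M c cs) + length (neg_queries M c cs) <= length cs.
Proof.
  revert c; induction cs as [|c' cs IH]; intros c; simpl; [lia|].
  rewrite !length_app; specialize (IH c'); unfold word in *.
  destruct (c_state c =? q_query M); [|simpl; lia].
  destruct (Nat.eqb_spec (c_state c') (q_yes M)) as [E|E];
  destruct (Nat.eqb_spec (c_state c') (q_no M)) as [E'|E'];
  destruct (Nat.eqb_spec (q_yes M) (q_no M)) as [E''|E'']; simpl; lia.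
Qed.

Lemma queries_length A M c cs w :
  chain A M c cs -> In w (pos_queries M c cs ++ neg_queries M c cs) ->
  length w <= length (c_oracle c) + length cs.
Proof.
  revert c; induction cs as [|c' cs IH]; intros c; simpl; [tauto|].
  intros [H1 H2] Hw; apply step_oracle in H1.
  assert (Hd : w = c_oracle c \/ In w (pos_queries M c' cs ++ neg_queries M c' cs)).
  { rewrite !in_app_iff in *.
    destruct (_ && _ && _)%bool in Hw; destruct (_ && _ && _)%bool in Hw; simpl in Hw;
    intuition (subst; auto). }
  destruct Hd as [->|Hd]; [lia|]. specialize (IH _ H2 Hd); lia.
Qed.

Lemma chain_queries A M c cs :
  chain A M c cs ->
  (forall w, In w (pos_queries M c cs) -> A w) /\
  (forall w, In w (neg_queries M c cs) -> ~ A w).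
Proof.
  revert c; induction cs as [|c' cs IH]; intros c; simpl; [tauto|].
  intros [H1 H2]; destruct (IH _ H2) as [Hp Hn].
  split; intros w Hw; apply in_app_iff in Hw; destruct Hw as [Hw|Hw]; auto;
  destruct (Nat.eqb_spec (c_state c) (q_query M)); simpl in Hw; try tauto.
  - destruct (Nat.eqb_spec (c_state c') (q_yes M)) as [E|]; simpl in Hw; [|tauto].
    destruct (Nat.eqb_spec (q_yes M) (q_no M)); simpl in Hw; [tauto|].
    destruct Hw as [<-|[]].
    destruct H1; simpl in *; congruence.
  - destruct (Nat.eqb_spec (c_state c') (q_no M)) as [E|]; simpl in Hw; [|tauto].
    destruct (Nat.eqb_spec (q_yes M) (q_no M)); simpl in Hw; [tauto|].
    destruct Hw as [<-|[]].
    destruct H1; simpl in *; congruence.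
Qed.

Lemma chain_transfer A B M c cs :
  chain A M c cs ->
  (forall w, In w (pos_queries M c cs) -> B w) ->
  (forall w, In w (neg_queries M c cs) -> ~ B w) ->
  chain B M c cs.
Proof.
  revert c; induction cs as [|c' cs IH]; intros c; simpl; [trivial|].
  intros [H1 H2] Hp Hn; split.
  - assert (Hp' := fun w H => Hp w (in_or_app _ _ _ (or_introl H))).
    assert (Hn' := fun w H => Hn w (in_or_app _ _ _ (or_introl H))).
    clear - H1 Hp' Hn'.
    destruct H1 as [c t ? ? ? ?|c H1 H2 H3|c H1 H2 H3]; [apply step_trans; assumption| |];
    simpl in Hp', Hn'; rewrite H2, Nat.eqb_refl in Hp', Hn';
    (* If [q_yes M = q_no M], both answers lead to the same successor, so the answer of [B] does not
       matter. *)
    (destruct (Nat.eq_dec (q_yes M) (q_no M)) as [E|E];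
     [rewrite ?E; destruct (classic (B (c_oracle c)));
      [rewrite <- ?E; apply step_query_yes; assumption|apply step_query_no; assumption]|rewrite (proj2 (Nat.eqb_neq _ _) E) in Hp', Hn']).
    + apply step_query_yes; trivial; apply Hp'; rewrite Nat.eqb_refl; now left.
    + apply step_query_no; trivial; apply Hn'; rewrite Nat.eqb_refl; now left.
  - apply IH; trivial; intros w Hw; [apply Hp|apply Hn]; apply in_or_app; now right.
Qed.

Lemma chain_agree n A B M c cs :
  agree n A B -> length (c_oracle c) + length cs < n -> chain A M c cs -> chain B M c cs.
Proof.
  intros HAB Hn H.
  assert (Hl : forall w, In w (pos_queries M c cs ++ neg_queries M c cs) -> (A w <-> B w)).
  { intros w Hw; apply HAB; pose proof (queries_length A M c cs w H Hw); lia. }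
  destruct (chain_queries A M c cs H) as [Hp Hq].
  apply (chain_transfer A); trivial; intros w Hw; rewrite <- Hl; auto;
  apply in_or_app; auto.
Qed.

(** * Polynomial bounds *)

(** The base is at least 2, so a single exponent absorbs constants, and a sum costs just one further
    factor. *)
Definition dominated (f : nat -> nat) : Prop := exists d, forall n, f n <= (n + 2) ^ d.

Lemma dominated_const c : dominated (fun _ => c).
Proof.
  exists c; intros n. apply Nat.le_trans with (2 ^ c).
  - pose proof (Nat.pow_gt_lin_r 2 c); lia.
  - apply Nat.pow_le_mono_l; lia.
Qed.

Lemma dominated_id : dominated (fun n => n).
Proof. exists 1; intros n; simpl; lia. Qed.

Lemma dominated_le f g : (forall n, f n <= g n) -> dominated g -> dominated f.
Proof. intros H [d Hd]; exists d; intros n; eapply Nat.le_trans; eauto. Qed.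

Lemma dominated_mul f g : dominated f -> dominated g -> dominated (fun n => f n * g n).
Proof.
  intros [a Ha] [b Hb]; exists (a + b); intros n; rewrite Nat.pow_add_r.
  now apply Nat.mul_le_mono.
Qed.

Lemma dominated_add f g : dominated f -> dominated g -> dominated (fun n => f n + g n).
Proof.
  intros [a Ha] [b Hb]; exists (1 + (a + b)); intros n; rewrite Nat.pow_add_r.
  specialize (Ha n); specialize (Hb n).
  assert (H1 : (n + 2) ^ a <= (n + 2) ^ (a + b)) by (apply Nat.pow_le_mono_r; lia).
  assert (H2 : (n + 2) ^ b <= (n + 2) ^ (a + b)) by (apply Nat.pow_le_mono_r; lia).
  rewrite Nat.pow_1_r. nia.
Qed.

Lemma dominated_pow f k : dominated f -> dominated (fun n => f n ^ k).
Proof.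
  intros H; induction k as [|k IH]; [exact (dominated_const 1)|].
  exact (dominated_mul _ _ H IH).
Qed.

Lemma poly_dominated f : poly_bounded f <-> dominated f.
Proof.
  split.
  - intros [k Hk]; apply (dominated_le _ _ Hk).
    apply dominated_add; [apply dominated_pow, dominated_id|apply dominated_const].
  - intros [d Hd]; exists (2 * d + 3 ^ d); intros n; eapply Nat.le_trans; [apply Hd|].
    destruct (le_lt_dec 2 n) as [Hn|Hn].
    + apply Nat.le_trans with (n ^ (2 * d)).
      * rewrite Nat.pow_mul_r; apply Nat.pow_le_mono_l; simpl; nia.
      * apply Nat.le_trans with (n ^ (2 * d + 3 ^ d)); [apply Nat.pow_le_mono_r|]; lia.
    + apply Nat.le_trans with (3 ^ d); [apply Nat.pow_le_mono_l|]; lia.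
Qed.

Lemma clock_mono n k l : k <= l -> n ^ k + k <= n ^ l + l.
Proof.
  intros H; destruct (Nat.eq_dec k l) as [->|]; [lia|].
  destruct n as [|n].
  (* Here [0 ^ 0 = 1] may exceed [0 ^ l]; the larger additive term compensates. *)
  - destruct l; [lia|]. destruct k; simpl; lia.
  - assert (S n ^ k <= S n ^ l) by (apply Nat.pow_le_mono_r; lia). lia.
Qed.

(** With [m = 2 ^ j] the inequality reduces to [(j + 3) * d < 2 ^ j]. The factor 3 is there because
    the witness of a proper claim has about a third of the claim's length, or more. *)
Lemma exp_beats_poly f b : dominated f -> exists m, b <= m /\ f (3 * m) < 2 ^ m.
Proof.
  intros [d Hd].
  assert (Hj : exists j, b <= j /\ (j + 3) * d < 2 ^ j).
  (* This exponent makes [2 ^ j] the cube of [e = 2 ^ (d + b + 3)], while [(j + 3) * d] is at most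
     three times the square of [e]. *)
  { exists (3 * (d + b + 3)); split; [lia|].
    pose proof (Nat.pow_gt_lin_r 2 (d + b + 3)).
    rewrite (Nat.mul_comm 3), Nat.pow_mul_r; set (e := 2 ^ (d + b + 3)) in *.
    assert (He : d + b + 4 <= e) by lia.
    assert (E1 : (d + b + 4) * (d + b + 4) <= e * e) by (apply Nat.mul_le_mono; lia).
    assert (E2 : e * e * 4 <= e * e * e) by (apply Nat.mul_le_mono; lia).
    simpl; nia. }
  destruct Hj as [j [Hb Hj]]; exists (2 ^ j); split.
  - pose proof (Nat.pow_gt_lin_r 2 j); lia.
  - eapply Nat.le_lt_trans; [apply Hd|].
    apply Nat.le_lt_trans with ((2 ^ (j + 3)) ^ d).
    + apply Nat.pow_le_mono_l; rewrite Nat.pow_add_r; simpl.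
      pose proof (Nat.pow_gt_lin_r 2 j); lia.
    + rewrite <- Nat.pow_mul_r; apply Nat.pow_lt_mono_r; lia.
Qed.

(** * Injective numbering of machines *)

Definition pair_code (a b : nat) : nat := Cantor.to_nat (a, b).

Lemma pair_code_inj a b a' b' : pair_code a b = pair_code a' b' -> a = a' /\ b = b'.
Proof. intros H; apply (Cantor.to_nat_inj (a, b) (a', b')) in H; now injection H. Qed.

Fixpoint list_code (l : list nat) : nat :=
  match l with [] => 0 | a :: l' => S (pair_code a (list_code l')) end.

Lemma list_code_inj l l' : list_code l = list_code l' -> l = l'.
Proof.
  revert l'; induction l as [|a l IH]; intros [|a' l']; simpl; try discriminate; trivial.
  intros H; injection H as H; apply pair_code_inj in H as [-> H]; f_equal; auto.
Qed.

Definition sym_code (a : sym) : nat :=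
  match a with None => 0 | Some false => 1 | Some true => 2 end.

Lemma sym_code_inj a a' : sym_code a = sym_code a' -> a = a'.
Proof. destruct a as [[]|], a' as [[]|]; simpl; congruence. Qed.

Definition move_code (d : move) : nat :=
  match d with MoveL => 0 | MoveR => 1 | Stay => 2 end.

Lemma move_code_inj d d' : move_code d = move_code d' -> d = d'.
Proof. destruct d, d'; simpl; congruence. Qed.

Definition trans_code (t : transition) : nat :=
  match t with
  | (q, a, q', b, d, o) =>
    list_code [q; sym_code a; q'; sym_code b; move_code d; sym_code o]
  end.

Lemma trans_code_inj t t' : trans_code t = trans_code t' -> t = t'.
Proof.
  destruct t as [[[[[q a] q'] b] d] o], t' as [[[[[p a'] p'] b'] d'] o'].
  unfold trans_code; intros H; apply list_code_inj in H; injection H as -> H1 -> H2 H3 H4.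
  apply sym_code_inj in H1, H2, H4; apply move_code_inj in H3; now subst.
Qed.

Definition machine_code (M : OTM) : nat :=
  pair_code (list_code (map trans_code (trans M)))
    (list_code [q_start M; q_acc M; q_query M; q_yes M; q_no M]).

Lemma machine_code_inj M M' : machine_code M = machine_code M' -> M = M'.
Proof.
  destruct M as [t a b c d e], M' as [t' a' b' c' d' e']; unfold machine_code; cbn [trans q_start q_acc q_query q_yes q_no].
  intros H; apply pair_code_inj in H as [H1 H2].
  apply list_code_inj in H2; injection H2 as -> -> -> -> ->.
  apply list_code_inj in H1; f_equal.
  revert t' H1; induction t as [|u t IH]; intros [|u' t']; simpl; try discriminate; trivial.
  intros H; injection H as H1 H2; apply trans_code_inj in H1; f_equal; auto.
Qed.

(** * Oracle words *)

(** The unary tag is self-delimiting and can be written by a chain of states without any counter on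
    the tape. *)
Definition tagged (t : nat) (w : word) : word := repeat true t ++ false :: w.

Lemma tagged_inj t t' w w' : tagged t w = tagged t' w' -> t = t' /\ w = w'.
Proof.
  revert t'; induction t as [|t IH]; intros [|t']; unfold tagged; simpl; intros H;
  injection H; try discriminate; auto.
  intros H'; apply IH in H' as [-> ->]; auto.
Qed.

(** Self-delimiting code: a [false] where a marker [true] is expected ends the word. *)
Definition doubled (x : word) : word := flat_map (fun b => [true; b]) x.

Lemma doubled_inj x x' u u' :
  doubled x ++ false :: u = doubled x' ++ false :: u' -> x = x' /\ u = u'.
Proof.
  revert x'; induction x as [|b x IH]; intros [|b' x']; simpl; intros H;
  try discriminate; injection H; auto.
  intros H' ->; apply IH in H' as [-> ->]; auto.
Qed.

Lemma length_doubled x : length (doubled x) = 2 * length x.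
Proof. induction x; simpl; lia. Qed.

(** Even tags belong to claims and clock words, odd ones to diagonal words. *)
Definition machine_tag (M : OTM) (k : nat) : nat := 2 * pair_code (machine_code M) k.

Lemma machine_tag_inj M k M' k' :
  machine_tag M k = machine_tag M' k' -> M = M' /\ k = k'.
Proof.
  unfold machine_tag; intros H.
  assert (E : pair_code (machine_code M) k = pair_code (machine_code M') k') by lia.
  apply pair_code_inj in E as [E ->]; split; trivial; now apply machine_code_inj.
Qed.

(** Fact and clock words share this format and differ only in their last bit, so one sweep of the
    search machine can write either. *)
Definition instance_word (t : nat) (x u : word) : word := tagged t (doubled x ++ false :: u).

(* [fact_word M k x z] claims, with witness [z], that [M] accepts [x] in space [length z];
   [clock_word M k x z] claims that [length z] is at least [threshold M k x]. *)
Definition fact_word M k (x z : word) : word := instance_word (machine_tag M k) x (z ++ [false]).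
Definition clock_word M k (x z : word) : word := instance_word (machine_tag M k) x (z ++ [true]).
Definition diag_word N (y : word) : word := tagged (2 * machine_code N + 1) y.

Lemma fact_word_inj M k x z M' k' x' z' :
  fact_word M k x z = fact_word M' k' x' z' -> M = M' /\ k = k' /\ x = x' /\ z = z'.
Proof.
  intros H; apply tagged_inj in H as [H1 H2]; apply doubled_inj in H2 as [H2 H3].
  apply machine_tag_inj in H1; apply app_inj_tail in H3; tauto.
Qed.

Lemma clock_word_inj M k x z M' k' x' z' :
  clock_word M k x z = clock_word M' k' x' z' -> M = M' /\ k = k' /\ x = x' /\ z = z'.
Proof.
  intros H; apply tagged_inj in H as [H1 H2]; apply doubled_inj in H2 as [H2 H3].
  apply machine_tag_inj in H1; apply app_inj_tail in H3; tauto.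
Qed.

Lemma fact_not_clock M k x z M' k' x' z' : fact_word M k x z <> clock_word M' k' x' z'.
Proof.
  intros H; apply tagged_inj in H as [H1 H2]; apply doubled_inj in H2 as [H2 H3].
  apply app_inj_tail in H3 as [_ H3]; discriminate.
Qed.

Lemma diag_word_inj N y N' y' : diag_word N y = diag_word N' y' -> N = N' /\ y = y'.
Proof.
  intros H; apply tagged_inj in H as [H1 H2]; split; trivial; apply machine_code_inj; lia.
Qed.

Lemma diag_not_fact N y M k x z : diag_word N y <> fact_word M k x z.
Proof. intros H; apply tagged_inj in H as [H _]; unfold machine_tag in H; lia. Qed.

Lemma diag_not_clock N y M k x z : diag_word N y <> clock_word M k x z.
Proof. intros H; apply tagged_inj in H as [H _]; unfold machine_tag in H; lia. Qed.

Lemma length_tagged t w : length (tagged t w) = t + 1 + length w.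
Proof. unfold tagged; rewrite length_app, repeat_length; simpl; lia. Qed.

Lemma length_instance_word t x u : length (instance_word t x u) = t + 2 * length x + length u + 2.
Proof.
  unfold instance_word; rewrite length_tagged, length_app, length_doubled; simpl; lia.
Qed.

Lemma length_fact_word M k x z :
  length (fact_word M k x z) = machine_tag M k + 2 * length x + length z + 3.
Proof. unfold fact_word; rewrite length_instance_word, length_app; simpl; lia. Qed.

Lemma length_diag_word N y : length (diag_word N y) = 2 * machine_code N + 2 + length y.
Proof. unfold diag_word; rewrite length_tagged; lia. Qed.

(** * Counting the words of a given length *)

Fixpoint all_words (n : nat) : list word :=
  match n with
  | 0 => [[]]
  | S n' => map (cons true) (all_words n') ++ map (cons false) (all_words n')
  end.

Lemma all_words_length n : length (all_words n) = 2 ^ n.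
Proof. induction n; simpl; trivial; rewrite length_app, !length_map; unfold word in *; lia. Qed.

Lemma in_all_words n w : In w (all_words n) <-> length w = n.
Proof.
  revert w; induction n as [|n IH]; intros w; simpl.
  - destruct w; simpl; intuition discriminate.
  - rewrite in_app_iff, !in_map_iff; split.
    + intros [[v [<- H]]|[v [<- H]]]; simpl; f_equal; now apply IH.
    + destruct w as [|[] w]; simpl; intros H; try discriminate; injection H as H;
      [left|right]; exists w; split; trivial; now apply IH.
Qed.

Lemma all_words_NoDup n : NoDup (all_words n).
Proof.
  induction n as [|n IH]; simpl; [repeat constructor; simpl; tauto|].
  apply NoDup_app.
  - apply NoDup_map_NoDup_ForallPairs; trivial; intros a b _ _ H; now injection H.
  - apply NoDup_map_NoDup_ForallPairs; trivial; intros a b _ _ H; now injection H.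
  - intros a Ha Hb; apply in_map_iff in Ha as [u [<- _]]; apply in_map_iff in Hb as [v [E _]].
    discriminate.
Qed.

Lemma fresh_word n (f : word -> word) (X : list word) :
  (forall z z', f z = f z' -> z = z') -> length X < 2 ^ n ->
  exists z, length z = n /\ ~ In (f z) X.
Proof.
  intros Hf HX; apply NNPP; intros H.
  assert (Hi : incl (map f (all_words n)) X).
  { intros w Hw; apply in_map_iff in Hw as [z [<- Hz]]; apply in_all_words in Hz.
    apply NNPP; intros Hn; apply H; now exists z. }
  apply NoDup_incl_length in Hi; [rewrite length_map, all_words_length in Hi; lia|].
  apply NoDup_map_NoDup_ForallPairs; [intros a b _ _; apply Hf|apply all_words_NoDup].
Qed.

(** * Valid oracles *)

(** One implication suffices, since [agree] is symmetric. *)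
Definition local (G : language -> language) : Prop :=
  forall A B w, agree (length w) A B -> G A w -> G B w.

Lemma local_fixpoint G : local G -> exists B : language, forall w, B w <-> G B w.
Proof.
  intros HG.
  (* [lev n] is the approximation that is already final on words shorter than [n]. *)
  pose (lev := fix lev n : language := match n with
    | 0 => fun _ => False
    | S n' => fun w => if length w <? n' then lev n' w else G (lev n') w end).
  assert (Hlev : forall n w, length w < n -> (lev n w <-> lev (S (length w)) w)).
  { induction n as [|n IH]; intros w Hw; [lia|].
    cbn [lev]; destruct (Nat.ltb_spec (length w) n) as [H|H].
    - rewrite (IH w H); cbn [lev]; now rewrite Nat.ltb_irrefl.
    - replace n with (length w) by lia; now rewrite Nat.ltb_irrefl. }
  exists (fun w => lev (S (length w)) w); intros w.
  assert (Ha : agree (length w) (lev (length w)) (fun v => lev (S (length v)) v))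
    by (intros v Hv; now apply Hlev).
  assert (Hs : lev (S (length w)) w <-> G (lev (length w)) w)
    by (cbn [lev]; now rewrite Nat.ltb_irrefl).
  rewrite Hs; split; intros H; eapply HG; eauto using agree_sym.
Qed.

(* The summands after [k] make every claim with witnesses of this length [proper] (see below)
   and the witnesses nonempty. *)
Definition threshold M k (x : word) : nat :=
  length x ^ k + k + length x + machine_tag M k + 1.

Definition is_clock : language := fun w =>
  exists M k x z, w = clock_word M k x z /\ threshold M k x <= length z.

Definition is_diag : language := fun w => exists N y, w = diag_word N y.

Definition is_fact : language := fun w => exists M k x z, w = fact_word M k x z.

(* Short witnesses are excluded so that a claim of length [l] has about [2 ^ (l / 3)]
   potential witnesses. *)
Definition proper M k (x : word) (s : nat) : Prop := length x + machine_tag M k <= s.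

Definition true_fact (B : language) : language := fun w =>
  exists M k x z, w = fact_word M k x z /\ proper M k x (length z) /\
    accepts_in_space B M x (length z).

(** [D] is the part chosen by the diagonalization. The remaining freedom is which witnesses
    accompany a true claim. *)
Definition valid (D B : language) : Prop :=
  (forall w, B w -> is_clock w \/ D w \/ true_fact B w) /\
  (forall w, is_clock w \/ D w -> B w) /\
  (forall M k x s, proper M k x s -> accepts_in_space B M x s ->
     exists z, length z = s /\ B (fact_word M k x z)).

Lemma true_fact_agree A B w : agree (length w) A B -> true_fact A w -> true_fact B w.
Proof.
  intros HAB (M & k & x & z & -> & Hp & Ha); exists M, k, x, z; repeat split; trivial.
  apply (accepts_in_space_agree _ A); trivial.
  apply (agree_le _ (length (fact_word M k x z))); trivial; rewrite length_fact_word; lia.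
Qed.

Lemma true_fact_is_fact B w : true_fact B w -> is_fact w.
Proof. intros (M & k & x & z & -> & _); now exists M, k, x, z. Qed.

Lemma fact_cases w : is_fact w -> ~ is_clock w /\ ~ is_diag w.
Proof.
  intros (M & k & x & z & ->); split.
  - intros (M' & k' & x' & z' & E & _); now apply fact_not_clock in E.
  - intros (N & y & E); symmetry in E; now apply diag_not_fact in E.
Qed.

Lemma diag_word_not_fact N y : ~ is_fact (diag_word N y).
Proof. intros Hf; apply fact_cases in Hf as [_ Hf]; apply Hf; now exists N, y. Qed.

Lemma valid_fact D B w :
  (forall v, D v -> is_diag v) -> valid D B -> is_fact w -> B w -> true_fact B w.
Proof.
  intros HD HB Hf Hw; destruct (fact_cases w Hf) as [H1 H2].
  apply HB in Hw as [?|[?|?]]; trivial; [tauto|]. exfalso; auto.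
Qed.

Lemma valid_nonfact D B w : valid D B -> ~ is_fact w -> (B w <-> is_clock w \/ D w).
Proof.
  intros HB Hf; split; [|apply HB]. intros Hw; apply HB in Hw as [?|[?|H]]; auto.
  now apply true_fact_is_fact in H.
Qed.

(** [B] is kept below [l]; from [l] on, all witnesses of true proper claims are put in except those
    in [X]. As [X] is too small to contain every witness of a claim, each true claim keeps one. *)
Lemma valid_extension D D' B l X :
  valid D B -> (forall w, D' w -> is_diag w) -> agree l D D' ->
  (forall s, l <= 3 * s + 3 -> length X < 2 ^ s) ->
  exists B', valid D' B' /\ agree l B B' /\
    (forall w, l <= length w -> is_fact w -> (B' w <-> true_fact B' w /\ ~ In w X)).
Proof.
  intros HB HD' HDD HX.
  destruct (local_fixpoint (fun O w =>
    (length w < l /\ B w) \/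
    (l <= length w /\ (is_clock w \/ D' w \/ (true_fact O w /\ ~ In w X))))) as [B' HB'].
  { intros A C w HAC [H|(H1 & [H|[H|[H2 H3]]])]; auto.
    right; split; trivial; right; right; split; trivial; now apply (true_fact_agree A). }
  assert (Hag : agree l B B').
  { intros w Hw; rewrite HB'; split; [auto|]. intros [[_ H]|[H _]]; [trivial|lia]. }
  assert (Hlt : forall w, length w < l -> (true_fact B w <-> true_fact B' w)).
  { intros w Hw; split; apply true_fact_agree; [|apply agree_sym];
    apply (agree_le _ l); trivial; lia. }
  exists B'; split; [split; [|split]|split; [trivial|]].
  - intros w Hw; apply HB' in Hw as [[H1 H2]|[H1 H2]].
    + apply HB in H2 as [H2|[H2|H2]]; auto.
      * right; left; now apply HDD.
      * right; right; now apply Hlt.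
    + tauto.
  - intros w Hw; apply HB'; destruct (le_lt_dec l (length w)) as [H|H]; [right|left]; split; trivial.
    + tauto.
    + apply HB; destruct Hw as [Hw|Hw]; auto; right; now apply HDD.
  - intros M k x s Hp Ha.
    destruct (le_lt_dec l (length (fact_word M k x (repeat true s)))) as [H|H];
    rewrite length_fact_word, repeat_length in H.
    + destruct (fresh_word s (fact_word M k x) X) as [z [Hz1 Hz2]].
      * intros z z' E; now apply fact_word_inj in E.
      (* For a proper claim the tag and twice the input take at most [2 * s], so its length is at
         most [3 * s + 3]. *)
      * apply HX; unfold proper in Hp; lia.
      * exists z; split; trivial; apply HB'; right; rewrite length_fact_word, Hz1.
        split; [lia|]. right; right; split; trivial.
        exists M, k, x, z; rewrite Hz1; auto.
    (* The claim is shorter than [l], hence was true in [B] already and keeps its witness from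
       there. *)
    + destruct HB as (_ & _ & HB). destruct (HB M k x s Hp) as [z [Hz1 Hz2]].
      * apply (accepts_in_space_agree _ B'); trivial; apply agree_sym.
        apply (agree_le _ l); trivial; lia.
      * exists z; split; trivial; apply Hag; trivial; rewrite length_fact_word; lia.
  - intros w Hl Hf; destruct (fact_cases w Hf) as [Hc Hd]; rewrite HB'; split; [|auto].
    intros [[? _]|[_ [?|[H|?]]]]; [lia|tauto| |trivial].
    exfalso; auto.
Qed.

(** * Diagonalization against one machine and one reduction *)

Section Diagonalization.

Context (N : OTM) (n : nat) (D0 B0 : language).
Context (T : Type) (ok : T -> Prop) (pos neg : T -> list word) (t bound : nat).

(** The length of the diagonal words of [N] that carry a witness of length [n]. *)
Let n0 := 2 * machine_code N + 2 + n.

Context (D0_diag : forall w, D0 w -> is_diag w)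
  (B0_valid : valid D0 B0)
  (queries_le : forall c, ok c -> length (pos c) + length (neg c) <= t)
  (queries_short : forall c w, ok c -> In w (pos c ++ neg c) -> length w < bound)
  (room : forall s, n0 <= 3 * s + 3 -> (t + 2) * (t + 2) < 2 ^ s)
  (room_n : (t + 2) * (t + 2) < 2 ^ n).

(** Certificates stay abstract in this section: only their positive and negative queries matter,
    which are bounded in number by [t] and in length by [bound]. *)
Definition consistent (B : language) (c : T) : Prop :=
  ok c /\ (forall w, In w (pos c) -> B w) /\ (forall w, In w (neg c) -> ~ B w).

Definition diag_set (S : language) : language := fun w =>
  D0 w \/ exists y, length y = n /\ S y /\ w = diag_word N y.

Definition extension (S : language) (B : language) : Prop :=
  valid (diag_set S) B /\ agree n0 B0 B.

(** The alternatives are: two certificates coexist, a one-element witness set has no certificate, an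
    empty one has a certificate. The first spoils the unambiguity of [N], the others the reduction.
    Only the first permits several elements in [S]. *)
Definition diagonalized : Prop := exists S B, extension S B /\
  ((exists c c', consistent B c /\ consistent B c' /\ c <> c') \/
   (exists y, length y = n /\ (forall z, S z <-> z = y) /\ forall c, ~ consistent B c) \/
   ((forall y, ~ S y) /\ exists c, consistent B c)).

Context (not_diagonalized : ~ diagonalized).

Lemma diag_set_diag S w : diag_set S w -> is_diag w.
Proof. intros [H|(y & _ & _ & ->)]; [auto|now exists N, y]. Qed.

(** The witness set may change only when [l = n0], since the new diagonal words have length [n0].
    The bound on [X] accommodates [t + 1] rounds that each avoid at most [t + 1] further words. *)
Lemma extend S S' B l X :
  extension S B -> n0 <= l -> (forall y, S y <-> S' y) \/ l = n0 ->
  length X < (t + 2) * (t + 2) ->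
  exists B', extension S' B' /\ agree l B B' /\
    (forall w, l <= length w -> is_fact w -> (B' w <-> true_fact B' w /\ ~ In w X)).
Proof.
  intros [HB Hag] Hl HS HX.
  destruct (valid_extension (diag_set S) (diag_set S') B l X) as (B' & H1 & H2 & H3); trivial.
  - apply diag_set_diag.
  - intros w Hw; unfold diag_set; destruct HS as [HS| ->].
    + split; (intros [H|(y & Hy & Hs & ->)]; [now left|right; exists y]);
      repeat split; trivial; now apply HS.
    + split; (intros [H|(y & Hy & Hs & ->)]; [now left|]);
      rewrite length_diag_word in Hw; unfold n0 in Hw; lia.
  - intros s Hs; specialize (room s); lia.
  - exists B'; split; [|now split]. split; trivial.
    apply (agree_trans _ _ B); trivial; now apply (agree_le _ l).
Qed.

Lemma extension_nonfact S B B' w :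
  extension S B -> extension S B' -> ~ is_fact w -> (B w <-> B' w).
Proof.
  intros [H _] [H' _] Hw; rewrite (valid_nonfact _ _ _ H Hw), (valid_nonfact _ _ _ H' Hw).
  reflexivity.
Qed.

(* Consistency of [c] with [B], except that claims of length at least [l] count as false. *)
Definition consistent_below (l : nat) (B : language) (c : T) : Prop :=
  ok c /\
  (forall w, In w (pos c) -> B w /\ ~ (is_fact w /\ l <= length w)) /\
  (forall w, In w (neg c) -> ~ B w \/ (is_fact w /\ l <= length w)).

(** [B1] and [B'] agree below [l] and on everything that is not a claim. The claims of length [l]
    asserted by [c] stay true and are not removed, longer ones are not asserted, and those denied by
    [c] lie in [X]. *)
Lemma combine_one S B l B1 B' c X :
  extension S B1 -> agree l B B1 -> consistent_below (Datatypes.S l) B1 c ->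
  extension S B' -> agree l B B' ->
  (forall w, l <= length w -> is_fact w -> (B' w <-> true_fact B' w /\ ~ In w X)) ->
  incl (neg c) X ->
  (forall w, is_fact w -> length w = l -> In w (pos c) -> ~ In w X) ->
  consistent B' c.
Proof.
  intros HB1 Ha1 (Hok & Hp & Hn) HB' Ha' HX Hincl Hcf; split; [trivial|split]; intros w Hw.
  - destruct (Hp w Hw) as [H1 H2].
    destruct (le_lt_dec l (length w)) as [Hl|Hl].
    + destruct (classic (is_fact w)) as [Hf|Hf]; [|now apply (extension_nonfact S B1 B')].
      assert (E : length w = l).
      { destruct (Nat.eq_dec (length w) l); trivial; exfalso; apply H2; split; trivial; lia. }
      apply HX; trivial; split; [|now apply Hcf].
      (* The truth of a claim of length [l] is determined below [l], where [B1] and [B']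
         coincide. *)
      apply (true_fact_agree B1).
      * rewrite E; apply (agree_trans _ _ B); [now apply agree_sym|trivial].
      * apply (valid_fact (diag_set S)); trivial; [apply diag_set_diag|apply HB1].
    + apply Ha', Ha1; trivial.
  - destruct (le_lt_dec l (length w)) as [Hl|Hl].
    + destruct (classic (is_fact w)) as [Hf|Hf].
      * rewrite (HX w Hl Hf); intros [_ H]; auto.
      * destruct (Hn w Hw) as [H|H]; [|tauto].
        now rewrite <- (extension_nonfact S B1 B').
    + destruct (Hn w Hw) as [H|[_ H]]; [|lia].
      intros H'; apply H, Ha1, Ha'; trivial.
Qed.

(** Otherwise an extension of [B] that avoids the negative queries of both certificates is
    consistent with both, which is the first alternative of [diagonalized]. *)
Lemma conflict S B l B1 B2 c1 c2 :
  n0 <= l -> extension S B -> extension S B1 -> extension S B2 ->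
  agree l B B1 -> agree l B B2 ->
  consistent_below (Datatypes.S l) B1 c1 -> consistent_below (Datatypes.S l) B2 c2 -> c1 <> c2 ->
  exists w, is_fact w /\ length w = l /\
    ((In w (pos c1) /\ In w (neg c2)) \/ (In w (pos c2) /\ In w (neg c1))).
Proof.
  intros Hl HB HB1 HB2 Ha1 Ha2 Hc1 Hc2 Hne; apply NNPP; intros Hno.
  assert (Hself : forall B' c w, consistent_below (Datatypes.S l) B' c -> is_fact w ->
     length w = l -> In w (pos c) -> ~ In w (neg c)).
  { intros B' c w (_ & Hp & Hn) Hf Hw H1 H2; apply Hp in H1; apply Hn in H2.
    destruct H2 as [H2|[_ H2]]; [tauto|lia]. }
  destruct (extend S S B l (neg c1 ++ neg c2)) as (B' & HB' & Ha' & HX); trivial.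
  - left; tauto.
  - pose proof (queries_le c1 (proj1 Hc1)); pose proof (queries_le c2 (proj1 Hc2)).
    rewrite length_app; lia.
  - apply not_diagonalized; exists S, B'; split; trivial; left; exists c1, c2; split; [|split; trivial].
    + apply (combine_one S B l B1 B' c1 (neg c1 ++ neg c2)); trivial.
      * apply incl_appl, incl_refl.
      * intros w Hf Hw Hp Hin; apply in_app_iff in Hin as [Hin|Hin].
        -- exact (Hself B1 c1 w Hc1 Hf Hw Hp Hin).
        -- apply Hno; exists w; auto.
    + apply (combine_one S B l B2 B' c2 (neg c1 ++ neg c2)); trivial.
      * apply incl_appr, incl_refl.
      * intros w Hf Hw Hp Hin; apply in_app_iff in Hin as [Hin|Hin].
        -- apply Hno; exists w; auto.
        -- exact (Hself B2 c2 w Hc2 Hf Hw Hp Hin).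
Qed.

(** The invariant of a descent from [bound] to [n0]: each level passed removes the asserted claims
    of one more length. *)
Definition clean_certificates (l : nat) : Prop := forall y B,
  length y = n -> extension (fun z => z = y) B -> exists c, consistent_below l B c.

(** The second alternative of [diagonalized] fails, so a certificate exists, and none of its queries
    reaches length [bound]. *)
Lemma clean_certificates_top : clean_certificates bound.
Proof.
  intros y B Hy HB; apply NNPP; intros Hno; apply not_diagonalized.
  exists (fun z => z = y), B; split; trivial; right; left; exists y; repeat split; trivial.
  intros c (Hok & Hp & Hn); apply Hno; exists c; split; [trivial|split]; intros w Hw.
  - split; [auto|]; intros [_ H].
    specialize (queries_short c w Hok (in_or_app _ _ _ (or_introl Hw))); lia.
  - auto.
Qed.

(* Certificates are produced one after the other, each for an oracle avoiding all claims
   that the previous ones mention.  Two distinct certificates must conflict, and by the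
   avoidance the conflict is a claim asserted by the earlier and denied by the later one;
   the denied claims obtained in this way are distinct, so there are at most [t]. *)
Lemma clean_certificates_step l : n0 <= l -> clean_certificates (S l) -> clean_certificates l.
Proof.
  intros Hl Hcl y B Hy HB; apply NNPP; intros Hno.
  set (Sy := fun z => z = y) in *.
  (* A certificate asserting no claim of length exactly [l] would be consistent below [l] with [B]
     itself. *)
  assert (Hpos : forall B' c, extension Sy B' -> agree l B B' -> consistent_below (S l) B' c ->
    exists p, In p (pos c) /\ is_fact p /\ length p = l).
  { intros B' c HB' Ha (Hok & Hp & Hn); apply NNPP; intros Hnp; apply Hno; exists c.
    split; [trivial|split]; intros w Hw.
    - destruct (Hp w Hw) as [H1 H2].
      destruct (classic (is_fact w)) as [Hf|Hf].
      + destruct (lt_eq_lt_dec (length w) l) as [[H|H]|H].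
        * split; [now apply Ha|lia].
        * exfalso; apply Hnp; now exists w.
        * exfalso; apply H2; split; trivial.
      + split; [|tauto]. now apply (extension_nonfact Sy B' B).
    - destruct (classic (is_fact w)) as [Hf|Hf].
      + destruct (le_lt_dec l (length w)) as [H|H]; [now right|left].
        destruct (Hn w Hw) as [H'|[_ H']]; [|lia]. intros HBw; apply H', Ha; trivial.
      + left; destruct (Hn w Hw) as [H'|[H' _]]; [|tauto].
        now rewrite (extension_nonfact Sy B B'). }
  assert (Hinv : forall j, j <= t + 1 -> exists X, length X <= j * t /\
    forall B' c, extension Sy B' -> agree l B B' ->
      (forall w, In w X -> is_fact w -> l <= length w -> ~ B' w) ->
      consistent_below (S l) B' c ->
      exists Y, NoDup Y /\ length Y = j /\ incl Y X /\ incl Y (neg c)).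
  { induction j as [|j IH]; intros Hj.
    - exists []; split; [trivial|]. intros; exists [].
      repeat split; [constructor|easy..].
    - destruct IH as (X & HX & IH); [lia|].
      destruct (extend Sy Sy B l X) as (B1 & HB1 & Ha1 & HX1); trivial; [left; tauto|unfold word in *; nia|].
      destruct (Hcl y B1 Hy HB1) as [c1 Hc1].
      assert (Hav1 : forall w, In w X -> is_fact w -> l <= length w -> ~ B1 w)
        by (intros w H1 H2 H3 H4; apply HX1 in H4; tauto).
      exists (X ++ pos c1 ++ neg c1); split.
      + pose proof (queries_le c1 (proj1 Hc1)); rewrite !length_app; unfold word in *; simpl; lia.
      + intros B' c HB' Ha' Hav Hc.
        destruct (IH B' c) as (Y & HY1 & HY2 & HY3 & HY4); trivial.
        { intros w Hw; apply Hav, in_or_app; now left. }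
        destruct (Hpos B' c) as (p & Hp1 & Hp2 & Hp3); trivial.
        assert (Hne : c1 <> c).
        { intros ->; apply (Hav p); trivial; [|lia|now apply Hc].
          rewrite !in_app_iff; auto. }
        destruct (conflict Sy B l B1 B' c1 c) as (w & Hw1 & Hw2 & [[Hw3 Hw4]|[Hw3 Hw4]]); trivial.
        (* The claim is new: [Y] lies in the old [X], whose long claims [B1] avoids, while [w] holds
           in [B1]. *)
        * assert (HwB1 : B1 w) by now apply Hc1.
          exists (w :: Y); repeat split.
          -- constructor; trivial; intros Hin; apply (Hav1 w); auto; lia.
          -- simpl; lia.
          -- intros v [<-|Hv]; rewrite !in_app_iff; auto.
          -- intros v [<-|Hv]; auto.
        (* A claim denied by [c1] belongs to the enlarged set, so [c] cannot assert it in [B']. *)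
        * exfalso; apply (Hav w); trivial; [|lia|now apply Hc].
          rewrite !in_app_iff; auto. }
  destruct (Hinv (t + 1)) as (X & HX & HX'); [lia|].
  destruct (extend Sy Sy B l X) as (B1 & HB1 & Ha1 & HX1); trivial; [left; tauto|unfold word in *; nia|].
  destruct (Hcl y B1 Hy HB1) as [c1 Hc1].
  destruct (HX' B1 c1) as (Y & HY1 & HY2 & _ & HY4); trivial.
  - intros w H1 H2 H3 H4; apply HX1 in H4; tauto.
  - pose proof (queries_le c1 (proj1 Hc1)).
    pose proof (NoDup_incl_length HY1 HY4); lia.
Qed.

Lemma clean_certificates_bottom : clean_certificates n0.
Proof.
  destruct (le_lt_dec n0 bound) as [H|H].
  - assert (Hd : forall d, d <= bound - n0 -> clean_certificates (bound - d)).
    { induction d as [|d IH]; intros Hd.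
      - rewrite Nat.sub_0_r; exact clean_certificates_top.
      - apply clean_certificates_step; [lia|].
        replace (S (bound - S d)) with (bound - d) by lia; apply IH; lia. }
    specialize (Hd (bound - n0) (le_n _)); now replace (bound - (bound - n0)) with n0 in Hd by lia.
  (* All queries are shorter than [n0], so no claim has to be eliminated. *)
  - intros y B Hy HB; destruct (clean_certificates_top y B Hy HB) as (c & Hok & Hp & Hn).
    exists c; split; [trivial|split]; intros w Hw.
    + split; [now apply Hp|].
      specialize (queries_short c w Hok (in_or_app _ _ _ (or_introl Hw))); lia.
    + left; destruct (Hn w Hw) as [?|[_ ?]]; trivial.
      specialize (queries_short c w Hok (in_or_app _ _ _ (or_intror Hw))); lia.
Qed.

Lemma base_extension : extension (fun _ => False) B0.
Proof.
  assert (E : forall w, diag_set (fun _ => False) w <-> D0 w).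
  { intros w; split; [|now left]. intros [H|(y & _ & [] & _)]; trivial. }
  split; [|intros w _; tauto]. destruct B0_valid as (H1 & H2 & H3); split; [|split; trivial].
  - intros w Hw; rewrite E; auto.
  - intros w; rewrite E; auto.
Qed.

(** A clean certificate asserts no claim from [n0] on, so apart from denied claims, which lie in
    [X], only the diagonal words of length [n0] can tell [B] from [B']. *)
Lemma combine_bottom y B S' B' c X :
  extension (fun z => z = y) B -> consistent_below n0 B c -> extension S' B' ->
  (forall w, n0 <= length w -> is_fact w -> (B' w <-> true_fact B' w /\ ~ In w X)) ->
  incl (neg c) X ->
  (In (diag_word N y) (pos c) -> S' y) ->
  (forall z, S' z -> z = y \/ ~ In (diag_word N z) (neg c)) ->
  consistent B' c.
Proof.
  intros HB (Hok & Hp & Hn) HB' HX Hincl Hy HS'; split; [trivial|split]; intros w Hw.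
  - destruct (Hp w Hw) as [H1 H2].
    destruct (le_lt_dec n0 (length w)) as [Hl|Hl].
    + assert (Hf : ~ is_fact w) by tauto.
      apply (valid_nonfact _ _ _ (proj1 HB')); trivial.
      apply (valid_nonfact _ _ _ (proj1 HB)) in H1; trivial.
      destruct H1 as [H1|[H1|(z & Hz & -> & ->)]]; [now left|right; now left|].
      right; right; exists y; auto.
    + now apply (proj2 HB'), (proj2 HB).
  - destruct (le_lt_dec n0 (length w)) as [Hl|Hl].
    + destruct (classic (is_fact w)) as [Hf|Hf].
      * rewrite (HX w Hl Hf); intros [_ H]; auto.
      * destruct (Hn w Hw) as [H|H]; [|tauto].
        intros HBw; apply H.
        apply (valid_nonfact _ _ _ (proj1 HB)); trivial.
        apply (valid_nonfact _ _ _ (proj1 HB')) in HBw; trivial.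
        destruct HBw as [H1|[H1|(z & Hz & Hs & ->)]]; [now left|right; now left|].
        destruct (HS' z Hs) as [->|H1]; [|tauto].
        right; right; exists y; auto.
    + destruct (Hn w Hw) as [H|[_ H]]; [|lia].
      intros H'; apply H, (proj2 HB), (proj2 HB'); trivial.
Qed.

(** Otherwise [c] would survive in an oracle with an empty witness set, the third alternative of
    [diagonalized]. *)
Lemma witness_asserted y B c :
  extension (fun z => z = y) B -> consistent_below n0 B c -> In (diag_word N y) (pos c).
Proof.
  intros HB Hc; apply NNPP; intros Hno.
  destruct (extend (fun _ => False) (fun _ => False) B0 n0 (neg c)) as (B' & HB' & _ & HX); trivial.
  - apply base_extension.
  - left; tauto.
  - pose proof (queries_le c (proj1 Hc)); unfold word in *; nia.
  - apply not_diagonalized; exists (fun _ => False), B'; split; trivial; right; right.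
    split; [tauto|]. exists c.
    apply (combine_bottom y B (fun _ => False) B' c (neg c)); trivial; [apply incl_refl|tauto..].
Qed.

(** Otherwise both certificates would be consistent with an oracle whose witness set consists of [y]
    and [y']. *)
Lemma diag_word_mentioned y y' B B' c c' :
  extension (fun z => z = y) B -> consistent_below n0 B c ->
  extension (fun z => z = y') B' -> consistent_below n0 B' c' -> c <> c' ->
  In (diag_word N y') (neg c) \/ In (diag_word N y) (neg c').
Proof.
  intros HB Hc HB' Hc' Hne; apply NNPP; intros Hno.
  destruct (extend (fun _ => False) (fun z => z = y \/ z = y') B0 n0 (neg c ++ neg c'))
    as (B2 & HB2 & _ & HX); trivial.
  - apply base_extension.
  - now right.
  - pose proof (queries_le c (proj1 Hc)); pose proof (queries_le c' (proj1 Hc')).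
    unfold word in *.
    rewrite length_app; lia.
  - apply not_diagonalized; exists (fun z => z = y \/ z = y'), B2; split; trivial; left.
    exists c, c'; split; [|split; trivial].
    + apply (combine_bottom y B (fun z => z = y \/ z = y') B2 c (neg c ++ neg c')); auto.
      * apply incl_appl, incl_refl.
      * intros z [->| ->]; auto.
    + apply (combine_bottom y' B' (fun z => z = y \/ z = y') B2 c' (neg c ++ neg c')); auto.
      * apply incl_appr, incl_refl.
      * intros z [->| ->]; auto.
Qed.

(** The counting of [clean_certificates_step], with witnesses instead of claims: each [y1] is chosen
    unmentioned by the earlier certificates, so every later certificate must deny the earlier
    witnesses, and [t + 1] of them are too many. *)
Lemma not_diagonalized_absurd : False.
Proof.
  assert (Hext : forall y, exists B, extension (fun z => z = y) B).
  { intros y; destruct (extend (fun _ => False) (fun z => z = y) B0 n0 []) as (B & HB & _); eauto.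
    - apply base_extension.
    - simpl; lia. }
  assert (Hinv : forall j, j <= t + 1 -> exists X, length X <= j * (t + 1) /\
    forall y B c, ~ In (diag_word N y) X -> extension (fun z => z = y) B ->
      consistent_below n0 B c ->
      exists Y, NoDup Y /\ length Y = j /\ incl Y X /\ incl Y (neg c)).
  { induction j as [|j IH]; intros Hj.
    - exists []; split; [trivial|]. intros; exists [].
      repeat split; [constructor|easy..].
    - destruct IH as (X & HX & IH); [lia|].
      destruct (fresh_word n (diag_word N) X) as (y1 & Hy1 & Hf1).
      { intros z z' E; now apply diag_word_inj in E. }
      { unfold word in *; nia. }
      destruct (Hext y1) as [B1 HB1].
      destruct (clean_certificates_bottom y1 B1 Hy1 HB1) as [c1 Hc1].
      exists (X ++ diag_word N y1 :: pos c1 ++ neg c1); split.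
      + pose proof (queries_le c1 (proj1 Hc1)).
        rewrite length_app; cbn [length]; rewrite length_app; unfold word in *; simpl; lia.
      + intros y B c Hfr HB Hc; rewrite in_app_iff in Hfr; simpl in Hfr.
        rewrite in_app_iff in Hfr.
        destruct (IH y B c) as (Y & HY1 & HY2 & HY3 & HY4); [tauto|trivial..|].
        pose proof (witness_asserted y B c HB Hc) as Hp.
        destruct (diag_word_mentioned y1 y B1 B c1 c) as [H|H]; trivial.
        * intros ->; tauto.
        * tauto.
        * exists (diag_word N y1 :: Y); repeat split.
          -- constructor; auto.
          -- simpl; lia.
          -- intros v [<-|Hv]; rewrite in_app_iff; simpl; auto.
          -- intros v [<-|Hv]; auto. }
  destruct (Hinv (t + 1)) as (X & HX & HX'); [lia|].
  destruct (fresh_word n (diag_word N) X) as (y1 & Hy1 & Hf1).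
  { intros z z' E; now apply diag_word_inj in E. }
  { unfold word in *; nia. }
  destruct (Hext y1) as [B1 HB1].
  destruct (clean_certificates_bottom y1 B1 Hy1 HB1) as [c1 Hc1].
  destruct (HX' y1 B1 c1) as (Y & HY1 & HY2 & _ & HY4); trivial.
  pose proof (queries_le c1 (proj1 Hc1)).
  pose proof (NoDup_incl_length HY1 HY4); lia.
Qed.

End Diagonalization.

(** * Construction of the oracle *)

Lemma step_deterministic A F c c1 c2 :
  deterministic F -> step A F c c1 -> step A F c c2 -> c1 = c2.
Proof.
  intros HF H1 H2; inversion H1; inversion H2; subst; try congruence; try tauto.
  f_equal; apply HF; trivial; congruence.
Qed.

(** No step leaves the accepting state, so neither run can be a proper prefix of the other. *)
Lemma accepting_run_unique A F c cs1 cs2 :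
  deterministic F -> chain A F c cs1 -> chain A F c cs2 ->
  c_state (last cs1 c) = q_acc F -> c_state (last cs2 c) = q_acc F -> cs1 = cs2.
Proof.
  intros HF; revert c cs2; induction cs1 as [|c1 cs1 IH]; intros c [|c2 cs2] H1 H2 E1 E2; trivial.
  - destruct H2 as [H2 _]; now apply step_not_acc in H2.
  - destruct H1 as [H1 _]; now apply step_not_acc in H1.
  - destruct H1 as [H1 H1'], H2 as [H2 H2'].
    assert (c1 = c2) as <- by now apply (step_deterministic A F c).
    rewrite last_cons in E1, E2; f_equal; eauto.
Qed.

Lemma length_output c : length (output c) <= space c.
Proof.
  unfold output, space; enough (length (read_word (c_right c)) <= length (c_right c)) by lia.
  induction (c_right c) as [|[b|] r IH]; simpl; lia.
Qed.

Lemma space_init M x : space (init M x) = length x.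
Proof. unfold space; simpl; rewrite length_map; lia. Qed.

(** * Certificates: a run of [F] followed by a run of [N] on its output *)

Section Certificates.

Context (F N : OTM) (k : nat) (x : word).

Definition first_output (c : list config * list config) : word :=
  output (last (fst c) (init F x)).

Definition certificate (A : language) (c : list config * list config) : Prop :=
  chain A F (init F x) (fst c) /\ c_state (last (fst c) (init F x)) = q_acc F /\
  length (fst c) <= length x ^ k + k /\
  acc_path A N (first_output c) (snd c) /\
  length (snd c) <= length (first_output c) ^ k + k.

Definition cert_pos (c : list config * list config) : list word :=
  pos_queries F (init F x) (fst c) ++ pos_queries N (init N (first_output c)) (snd c).

Definition cert_neg (c : list config * list config) : list word :=
  neg_queries F (init F x) (fst c) ++ neg_queries N (init N (first_output c)) (snd c).

(** The second summand clocks [N] on the longest possible output of [F], which grows by at most 2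
    per step. *)
Definition cert_size (n : nat) : nat := (n ^ k + k) + ((n + 2 * (n ^ k + k)) ^ k + k).

Lemma certificate_size A c :
  certificate A c -> length (fst c) + length (snd c) <= cert_size (length x).
Proof.
  intros (H1 & _ & H2 & _ & H3); unfold cert_size.
  assert (H : length (first_output c) <= length x + 2 * (length x ^ k + k)).
  { unfold first_output; eapply Nat.le_trans; [apply length_output|].
    apply chain_space in H1; rewrite space_init in H1; lia. }
  apply (Nat.pow_le_mono_l _ _ k) in H; lia.
Qed.

(** [ok] admits the certificates of all oracles; the recorded queries alone decide which of them are
    certificates for [B]. *)
Lemma certificate_consistent B c :
  consistent _ (fun c => exists A, certificate A c) cert_pos cert_neg B c <-> certificate B c.
Proof.
  split.
  - intros ([A (H1 & H2 & H3 & [H4 H5] & H6)] & Hp & Hn); unfold cert_pos, cert_neg in *.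
    repeat split; trivial.
    + apply (chain_transfer A); trivial; intros w Hw; [apply Hp|apply Hn]; apply in_or_app; auto.
    + apply (chain_transfer A); trivial; intros w Hw; [apply Hp|apply Hn]; apply in_or_app; auto.
  - intros H; split; [now exists B|]. destruct H as (H1 & _ & _ & [H4 _] & _).
    apply chain_queries in H1, H4; unfold cert_pos, cert_neg.
    split; intros w Hw; apply in_app_iff in Hw as [Hw|Hw]; try now apply H1.
    all: now apply H4.
Qed.

Lemma cert_queries_count A c :
  certificate A c -> length (cert_pos c) + length (cert_neg c) <= cert_size (length x).
Proof.
  intros H; apply certificate_size in H; unfold cert_pos, cert_neg; rewrite !length_app.
  pose proof (queries_count F (init F x) (fst c)).
  pose proof (queries_count N (init N (first_output c)) (snd c)). lia.
Qed.

Lemma cert_queries_length A c w :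
  certificate A c -> In w (cert_pos c ++ cert_neg c) -> length w < cert_size (length x) + 1.
Proof.
  intros H; pose proof (certificate_size A c H); destruct H as (H1 & _ & _ & [H4 _] & _).
  unfold cert_pos, cert_neg; rewrite !in_app_iff; intros Hw.
  destruct Hw as [[Hw|Hw]|[Hw|Hw]].
  1, 3: apply (queries_length A F (init F x) (fst c) w) in H1; [simpl in H1; lia|].
  3, 4: apply (queries_length A N (init N (first_output c)) (snd c) w) in H4; [simpl in H4; lia|].
  all: apply in_or_app; auto.
Qed.

Lemma certificate_agree A B c :
  agree (cert_size (length x) + 1) A B -> certificate A c -> certificate B c.
Proof.
  intros HAB H; pose proof (certificate_size A c H) as Hs.
  destruct H as (H1 & H2 & H3 & [H4 H5] & H6); repeat split; trivial;
  eapply chain_agree; eauto; simpl; lia.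
Qed.

End Certificates.

Definition good (D B : language) (m : nat) : Prop :=
  valid D B /\ (forall w, D w -> is_diag w) /\ (forall w, D w -> length w < m).

(** Quantifying over every [A] that agrees with [B] below [m] makes the property survive all later
    stages, and likewise for [not_reduced]. *)
Definition destroyed (N : OTM) (B : language) (m : nat) : Prop :=
  forall A, agree m B A ->
    exists q cs cs', acc_path A N q cs /\ acc_path A N q cs' /\ cs <> cs'.

Definition has_witness (N : OTM) (A : language) (n : nat) : Prop :=
  exists y, length y = n /\ A (diag_word N y).

Definition not_reduced (F N : OTM) (k : nat) (B : language) (m : nat) : Prop :=
  exists n, forall A, agree m B A ->
    ~ (has_witness N A n <-> exists c, certificate F N k (repeat true n) A c).

Definition unambiguous_or_destroyed (B : language) (m m' : nat) : Prop :=
  forall N y y', length y = length y' -> m <= length (diag_word N y) < m' ->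
    B (diag_word N y) -> B (diag_word N y') -> y <> y' -> destroyed N B m'.

Lemma stage F N k D B m :
  deterministic F -> good D B m ->
  exists D' B' m', good D' B' m' /\ m < m' /\ agree m B B' /\
    unambiguous_or_destroyed B' m m' /\ (destroyed N B' m' \/ not_reduced F N k B' m').
Proof.
  intros HF (HB & HD & Hm).
  (* With [n = 3 * h], both [n] and every [s] with [n0 <= 3 * s + 3] are at least [h]; since [h]
     exceeds [m], the new diagonal words lie beyond everything fixed so far. *)
  destruct (exp_beats_poly (fun n => (cert_size k n + 2) * (cert_size k n + 2)) (m + 1))
    as [h [Hh1 Hh2]].
  { assert (Hc : dominated (fun n => n ^ k + k))
      by (apply dominated_add; [apply dominated_pow, dominated_id|apply dominated_const]).
    assert (Hs : dominated (fun n => cert_size k n + 2)).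
    { apply dominated_add; [|apply dominated_const]. apply dominated_add; trivial.
      apply dominated_add; [|apply dominated_const]. apply dominated_pow.
      apply dominated_add; [apply dominated_id|].
      apply dominated_mul; [apply dominated_const|trivial]. }
    now apply dominated_mul. }
  set (n := 3 * h) in *; set (x := repeat true n).
  assert (Hx : length x = n) by apply repeat_length.
  set (n0 := 2 * machine_code N + 2 + n).
  (* Beyond the diagonal words of length [n0] and beyond all queries of certificates. *)
  set (m' := n0 + cert_size k n + 2).
  assert (Hdg : forall y, length (diag_word N y) = n0 <-> length y = n)
    by (intros y; rewrite length_diag_word; lia).
  destruct (classic (diagonalized N n D B _ (fun c => exists A, certificate F N k x A c)
    (cert_pos F N x) (cert_neg F N x))) as [H|H].
  2: { exfalso; refine (not_diagonalized_absurd N n D B _ (fun c => exists A, certificate F N k x A c)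
         (cert_pos F N x) (cert_neg F N x) (cert_size k n) (cert_size k n + 1) HD HB _ _ _ _ H).
       - intros c [A Hc]; apply cert_queries_count in Hc; now rewrite Hx in Hc.
       - intros c w [A Hc] Hw; apply (cert_queries_length F N k x A c w Hc) in Hw.
         now rewrite Hx in Hw.
       - intros s Hs; eapply Nat.lt_le_trans; [exact Hh2|]. apply Nat.pow_le_mono_r; lia.
       - eapply Nat.lt_le_trans; [exact Hh2|]. apply Nat.pow_le_mono_r; lia. }
  destruct H as (S & B' & [HB' Hag] & Hcase).
  assert (Hloc : forall A c, agree m' B' A -> (certificate F N k x A c <-> certificate F N k x B' c)).
  { intros A c HA; split; apply certificate_agree; rewrite Hx; [apply agree_sym|];
    apply (agree_le _ m'); trivial; lia. }
  assert (Hwit : forall y, length y = n -> (S y <-> B' (diag_word N y))).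
  { intros y Hy.
    assert (Hnf := diag_word_not_fact N y).
    rewrite (valid_nonfact _ _ _ HB' Hnf); split.
    - intros HS; right; right; now exists y.
    - intros [(M & k' & x' & z & E & _)|[HDy|(z & Hz & HS & E)]].
      + now apply diag_not_clock in E.
      + apply Hm in HDy; rewrite (proj2 (Hdg y) Hy) in HDy; lia.
      + apply diag_word_inj in E as [_ ->]; trivial. }
  assert (Hwit' : forall A, agree m' B' A -> (has_witness N A n <-> exists y, length y = n /\ S y)).
  { intros A HA; split; intros [y [Hy H]]; exists y; split; trivial.
    - apply Hwit; trivial; apply HA; trivial; rewrite (proj2 (Hdg y) Hy); lia.
    - apply Hwit in H; trivial; apply HA in H; trivial; rewrite (proj2 (Hdg y) Hy); lia. }
  assert (Hdes : (exists c c', certificate F N k x B' c /\ certificate F N k x B' c' /\ c <> c') ->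
    destroyed N B' m').
  { intros (c & c' & Hc & Hc' & Hne) A HA.
    apply (Hloc A c HA) in Hc; apply (Hloc A c' HA) in Hc'.
    destruct c as [cf cn], c' as [cf' cn'].
    destruct Hc as (H1 & H2 & _ & H3 & _), Hc' as (H1' & H2' & _ & H3' & _); simpl in *.
    (* [F] is deterministic, so the certificates differ in their runs of [N], which start from the
       same word. *)
    assert (cf = cf') as <- by now apply (accepting_run_unique A F (init F x)).
    exists (first_output F x (cf, cn)), cn, cn'; repeat split; try apply H3; try apply H3'.
    congruence. }
  exists (diag_set N n D S), B', m'; split; [|split; [lia|split; [|split]]].
  - split; [trivial|split].
    + now apply diag_set_diag.
    + intros w [Hw|(y & Hy & _ & ->)]; [apply Hm in Hw; lia|].
      rewrite (proj2 (Hdg y) Hy); lia.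
  - apply (agree_le _ n0); [lia|trivial].
  - intros N' y y' Hy Hl H H' Hne.
    assert (Hin : forall v, length v = length y -> B' (diag_word N' v) ->
      N' = N /\ length v = n /\ S v).
    { intros v Hv HBv.
      assert (Hnf := diag_word_not_fact N' v).
      apply (valid_nonfact _ _ _ HB' Hnf) in HBv.
      destruct HBv as [(M & k' & x' & z & E & _)|[HDy|(z & Hz & HS & E)]].
      - now apply diag_not_clock in E.
      - apply Hm in HDy; rewrite length_diag_word in *; lia.
      - apply diag_word_inj in E as [-> ->]; auto. }
    destruct (Hin y eq_refl H) as (-> & Hy1 & HS1).
    destruct (Hin y' (eq_sym Hy) H') as (_ & Hy2 & HS2).
    (* Two distinct elements of [S] leave only the alternative with two certificates. *)
    destruct Hcase as [Hc|[(v & _ & Hv & _)|[Hc _]]].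
    + apply Hdes; destruct Hc as (c & c' & Hc & Hc' & Hcc); exists c, c'.
      now rewrite !certificate_consistent in *.
    + apply Hv in HS1, HS2; congruence.
    + now apply Hc in HS1.
  - destruct Hcase as [Hc|[(v & Hv1 & Hv & Hno)|[Hno [c Hc]]]].
    + left; apply Hdes; destruct Hc as (c & c' & Hc & Hc' & Hcc); exists c, c'.
      now rewrite !certificate_consistent in *.
    + right; exists n; intros A HA E.
      destruct (proj1 E) as [c Hc].
      * apply Hwit'; trivial; exists v; split; trivial; now apply Hv.
      * apply (Hno c); apply certificate_consistent; now apply (Hloc A).
    + right; exists n; intros A HA E.
      destruct (proj1 (Hwit' A HA)) as [y [_ Hy]]; [|now apply Hno in Hy].
      apply E; exists c; apply (Hloc A); trivial.
      now apply certificate_consistent in Hc.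
Qed.

(** * The sequence of stages and its limit *)

Definition triple_code (F N : OTM) (k : nat) : nat :=
  pair_code (machine_code F) (pair_code (machine_code N) k).

Lemma triple_code_inj F N k F' N' k' :
  triple_code F N k = triple_code F' N' k' -> F = F' /\ N = N' /\ k = k'.
Proof.
  intros H; apply pair_code_inj in H as [H1 H]; apply pair_code_inj in H as [H2 ->].
  now apply machine_code_inj in H1, H2.
Qed.

Definition stage_relation (i : nat) (s s' : language * language * nat) : Prop :=
  match s, s' with
  | (_, B, m), (_, B', m') =>
    m < m' /\ agree m B B' /\ unambiguous_or_destroyed B' m m' /\
    forall F N k, deterministic F -> triple_code F N k = i ->
      destroyed N B' m' \/ not_reduced F N k B' m'
  end.

Definition good_state (s : language * language * nat) : Prop :=
  match s with (D, B, m) => good D B m end.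

Lemma next_state i s : good_state s -> exists s', good_state s' /\ stage_relation i s s'.
Proof.
  destruct s as [[D B] m]; intros Hs.
  destruct (classic (exists F N k, deterministic F /\ triple_code F N k = i))
    as [(F & N & k & HF & Hi)|H].
  - destruct (stage F N k D B m HF Hs) as (D' & B' & m' & H1 & H2 & H3 & H4 & H5).
    exists (D', B', m'); split; [trivial|]. repeat split; trivial; [now apply H3..|].
    intros F' N' k' _ H'; rewrite <- Hi in H'; apply triple_code_inj in H' as (-> & -> & ->).
    trivial.
  (* No triple has code [i]: only the bound grows, and no diagonal word has length [m]. *)
  - exists (D, B, S m); split.
    + destruct Hs as (H1 & H2 & H3); repeat split; trivial; try apply H1.
      intros w Hw; apply H3 in Hw; lia.
    + split; [lia|split; [intros w _; tauto|split]].
      * intros N y y' Hy Hl Hb _ _; exfalso.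
        assert (Hnf := diag_word_not_fact N y).
        destruct Hs as (H1 & H2 & H3).
        apply (valid_nonfact _ _ _ H1 Hnf) in Hb as [(M & k' & x' & z & E & _)|Hb].
        -- now apply diag_not_clock in E.
        -- apply H3 in Hb; lia.
      * intros F N k HF Hi; exfalso; apply H; now exists F, N, k.
Qed.

Lemma initial_state : exists B, good (fun _ => False) B 0.
Proof.
  destruct (local_fixpoint (fun O w => is_clock w \/ true_fact O w)) as [B HB].
  { intros A C w HAC [H|H]; auto; right; now apply (true_fact_agree A). }
  exists B; split; [|split; tauto]. split; [|split].
  - intros w Hw; apply HB in Hw; tauto.
  - intros w Hw; apply HB; tauto.
  - intros M k x s Hp Ha; exists (repeat true s); split; [apply repeat_length|].
    apply HB; right; exists M, k, x, (repeat true s); rewrite repeat_length; auto.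
Qed.

Lemma stage_sequence : exists seq : nat -> language * language * nat,
  (forall i, good_state (seq i)) /\ (forall i, stage_relation i (seq i) (seq (S i))) /\
  snd (seq 0) = 0.
Proof.
  destruct initial_state as [B HB].
  (* Each state carries its invariant, which the next use of choice needs. *)
  pose (nxt i (s : {s | good_state s}) :=
    let H := constructive_indefinite_description _ (next_state i (proj1_sig s) (proj2_sig s)) in
    exist good_state (proj1_sig H) (proj1 (proj2_sig H))).
  pose (sq := fix sq i := match i with
    | 0 => exist good_state (fun _ => False, B, 0) HB
    | S i' => nxt i' (sq i') end).
  exists (fun i => proj1_sig (sq i)); split; [|split; trivial].
  - intros i; exact (proj2_sig (sq i)).
  - intros i; exact (proj2 (proj2_sig (constructive_indefinite_description _
      (next_state i (proj1_sig (sq i)) (proj2_sig (sq i)))))).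
Qed.

Theorem diagonal_oracle : exists A : language,
  valid (fun w => is_diag w /\ A w) A /\
  forall C, UP A C -> exists N,
    (forall y y', length y = length y' -> A (diag_word N y) -> A (diag_word N y') -> y = y') /\
    ~ mreduces A (fun x => has_witness N A (length x)) C.
Proof.
  destruct stage_sequence as (seq & Hgood & Hrel & H0).
  set (Bs i := snd (fst (seq i))); set (ms i := snd (seq i)).
  assert (Hlt : forall i, ms i < ms (S i)).
  { intros i; specialize (Hrel i); unfold ms.
    destruct (seq i) as [[D B] m], (seq (S i)) as [[D' B'] m']; apply Hrel. }
  assert (Hge : forall i, i <= ms i).
  { induction i as [|i IH]; [lia|]. specialize (Hlt i); lia. }
  assert (Hmono : forall i j, i <= j -> ms i <= ms j).
  { intros i j H; induction H as [|j _ IH]; [lia|]. specialize (Hlt j); lia. }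
  assert (Hag1 : forall i, agree (ms i) (Bs i) (Bs (S i))).
  { intros i; specialize (Hrel i); unfold ms, Bs.
    destruct (seq i) as [[D B] m], (seq (S i)) as [[D' B'] m']; apply Hrel. }
  assert (Hag2 : forall i j, i <= j -> agree (ms i) (Bs i) (Bs j)).
  { intros i j H; induction H as [|j H IH]; [intros w _; tauto|].
    apply (agree_trans _ _ (Bs j)); trivial. apply (agree_le _ (ms j)); auto. }
  (* Stage [i] fixes at least the words shorter than [i], so [w] is settled by stage
     [S (length w)]. *)
  pose (A := fun w => Bs (S (length w)) w).
  assert (HA : forall i, agree (ms i) (Bs i) A).
  { intros i w Hw; unfold A; destruct (le_lt_dec i (S (length w))) as [H|H].
    - now apply (Hag2 i).
    - symmetry; apply (Hag2 (S (length w)) i); [lia|]. specialize (Hge (S (length w))); lia. }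
  exists A; split; [split; [|split]|].
  - intros w Hw; assert (HBw := Hw); unfold A in HBw; specialize (Hgood (S (length w))).
    assert (Hm := HA (S (length w))); specialize (Hge (S (length w))).
    unfold Bs, ms in *; destruct (seq (S (length w))) as [[D B] m]; simpl in *.
    destruct Hgood as (H1 & H2 & H3).
    apply H1 in HBw as [H|[H|H]]; auto.
    right; right; apply (true_fact_agree B); trivial; apply (agree_le _ m); trivial; lia.
  - intros w [Hw|Hw]; [|tauto]. unfold A, Bs; specialize (Hgood (S (length w))).
    destruct (seq (S (length w))) as [[D B] m]; apply Hgood; now left.
  - intros M k x s Hp Ha; set (i := S (length (fact_word M k x (repeat true s)))).
    assert (Hi : length (fact_word M k x (repeat true s)) < ms i) by (specialize (Hge i); lia).
    rewrite length_fact_word, repeat_length in Hi.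
    assert (Hm := HA i); specialize (Hgood i); unfold ms, Bs in *.
    destruct (seq i) as [[D B] m]; simpl in *; destruct Hgood as ((_ & _ & H) & _).
    destruct (H M k x s Hp) as [z [Hz1 Hz2]].
    + apply (accepts_in_space_agree _ A); trivial; apply agree_sym, (agree_le _ m); trivial; lia.
    + exists z; split; trivial; apply Hm; trivial; rewrite length_fact_word; lia.
  - intros C (N & pN & HpN & HtN & HuN & HC).
    assert (Hnd : forall i, ~ destroyed N (Bs i) (ms i)).
    { intros i Hd; destruct (Hd A (HA i)) as (q & cs & cs' & H1 & H2 & H3).
      apply H3; eauto. }
    exists N; split.
    + intros y y' Hy H H'; apply NNPP; intros Hne.
      (* The bounds start at 0 and increase strictly, so every length falls between two consecutive
         ones. *)
      assert (Hi : exists i, ms i <= length (diag_word N y) < ms (S i)).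
      { assert (Hi : length (diag_word N y) < ms (S (length (diag_word N y))))
          by (specialize (Hge (S (length (diag_word N y)))); lia).
        revert Hi; generalize (S (length (diag_word N y))) as i.
        induction i as [|i IH]; intros Hi; [unfold ms in Hi; lia|].
        destruct (le_lt_dec (ms i) (length (diag_word N y))) as [Hl|Hl]; [now exists i|auto]. }
      destruct Hi as [i Hi]; apply (Hnd (S i)).
      assert (Hu : unambiguous_or_destroyed (Bs (S i)) (ms i) (ms (S i))).
      { specialize (Hrel i); unfold ms, Bs.
        destruct (seq i) as [[D B] m], (seq (S i)) as [[D' B'] m']; apply Hrel. }
      assert (Hl : length (diag_word N y) = length (diag_word N y'))
        by (rewrite !length_diag_word; lia).
      apply (Hu N y y'); trivial; apply HA; trivial; lia.
    + intros (f & (F & pF & HF & HpF & HtF & Hf) & Hred).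
      destruct HpN as [k1 Hk1], HpF as [k2 Hk2].
      (* [clock_mono] lets one exponent clock both machines. *)
      set (k := k1 + k2); set (i := triple_code F N k).
      assert (Hs : destroyed N (Bs (S i)) (ms (S i)) \/ not_reduced F N k (Bs (S i)) (ms (S i))).
      { specialize (Hrel i); unfold ms, Bs.
        destruct (seq i) as [[D B] m], (seq (S i)) as [[D' B'] m']; now apply Hrel. }
      destruct Hs as [Hs|[n Hs]]; [now apply Hnd in Hs|].
      apply (Hs A (HA (S i))); set (x := repeat true n).
      assert (Hx : length x = n) by apply repeat_length.
      rewrite <- Hx at 1; rewrite (Hred x), HC.
      destruct (Hf x) as (c & (cs & Hcs1 & Hcs2) & Hc1 & Hc2); subst c; split.
      * intros [cs' Hcs']; exists (cs, cs'); unfold certificate, first_output; simpl.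
        rewrite Hc2; repeat split; trivial; try apply Hcs'.
        -- eapply Nat.le_trans; [apply HtF, Hcs1|]. eapply Nat.le_trans; [apply Hk2|].
           apply clock_mono; lia.
        -- eapply Nat.le_trans; [apply (HtN (f x)), Hcs'|]. eapply Nat.le_trans; [apply Hk1|].
           apply clock_mono; lia.
      * intros [[cf cn] (H1 & H2 & _ & H3 & _)]; unfold first_output in H3; simpl in *.
        assert (cf = cs) as -> by now apply (accepting_run_unique A F (init F x)).
        exists cn; now rewrite <- Hc2.
Qed.

(** * Deterministic runs of table-driven machines *)

Definition action : Type := (nat * sym * move * option bool)%type.

Definition make_transition (q : nat) (a : sym) (r : action) : transition :=
  match r with (q', b, d, o) => (q, a, q', b, d, o) end.

Definition table (Q : nat) (delta : nat -> sym -> list action) : list transition :=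
  flat_map (fun q => flat_map (fun a => map (make_transition q a) (delta q a))
    [None; Some false; Some true]) (seq 0 Q).

Lemma in_table Q delta t :
  In t (table Q delta) <-> exists q a r, q < Q /\ In r (delta q a) /\ t = make_transition q a r.
Proof.
  unfold table; rewrite in_flat_map; split.
  - intros [q [Hq H]]; apply in_seq in Hq; apply in_flat_map in H as [a [_ H]].
    apply in_map_iff in H as [r [<- Hr]]; exists q, a, r; repeat split; trivial; lia.
  - intros (q & a & r & Hq & Hr & ->); exists q; split; [apply in_seq; lia|].
    apply in_flat_map; exists a; split; [destruct a as [[]|]; simpl; auto|now apply in_map].
Qed.

Lemma table_deterministic Q delta :
  (forall q a, length (delta q a) <= 1) ->
  forall t1 t2, In t1 (table Q delta) -> In t2 (table Q delta) ->
    trans_src t1 = trans_src t2 -> t1 = t2.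
Proof.
  intros H t1 t2 H1 H2 E.
  apply in_table in H1 as (q & a & r & _ & Hr & ->).
  apply in_table in H2 as (q' & a' & r' & _ & Hr' & ->).
  destruct r as [[[? ?] ?] ?], r' as [[[? ?] ?] ?]; simpl in E; injection E as <- <-.
  specialize (H q a); destruct (delta q a) as [|r0 [|r1 l]]; simpl in *; [tauto| |lia].
  intuition congruence.
Qed.

(* The unique run from [c] reaches [c'] after at most [n] steps. *)
Inductive drun (A : language) (M : OTM) : nat -> config -> config -> Prop :=
| drun_refl n c : drun A M n c c
| drun_step n c c1 c' :
    step A M c c1 -> (forall c2, step A M c c2 -> c2 = c1) ->
    drun A M n c1 c' -> drun A M (S n) c c'.

Lemma drun_le A M m n c c' : m <= n -> drun A M m c c' -> drun A M n c c'.
Proof.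
  intros H R; revert n H; induction R as [m c|m c c1 c' H1 H2 _ IH]; intros n H; [constructor|].
  destruct n as [|n]; [lia|]. apply drun_step with c1; trivial; apply IH; lia.
Qed.

Lemma drun_trans A M m n c c1 c' :
  drun A M m c c1 -> drun A M n c1 c' -> drun A M (m + n) c c'.
Proof.
  intros R; induction R as [m c|m c c1 c2 H1 H2 _ IH]; intros R'.
  - apply (drun_le _ _ n); [lia|trivial].
  - simpl; apply drun_step with c1; auto.
Qed.

(** This property and the next three are relative to a configuration so that a deterministic run can
    carry them from its end back to its start. *)
Definition accepts_from (A : language) (M : OTM) (c : config) : Prop :=
  exists cs, chain A M c cs /\ c_state (last cs c) = q_acc M.

Definition halts_within (A : language) (M : OTM) (c : config) (m : nat) : Prop :=
  forall cs, chain A M c cs -> length cs <= m.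

Definition space_within (A : language) (M : OTM) (c : config) (s : nat) : Prop :=
  forall cs, chain A M c cs -> space (last cs c) <= s.

Definition unambiguous_from (A : language) (M : OTM) (c : config) : Prop :=
  forall cs1 cs2, chain A M c cs1 -> c_state (last cs1 c) = q_acc M ->
    chain A M c cs2 -> c_state (last cs2 c) = q_acc M -> cs1 = cs2.

Lemma accepts_from_step A M c :
  c_state c <> q_acc M ->
  (accepts_from A M c <-> exists c', step A M c c' /\ accepts_from A M c').
Proof.
  intros Hc; split.
  - intros [[|c1 cs] [H1 H2]]; [now simpl in H2|].
    destruct H1 as [H1 H3]; rewrite last_cons in H2; exists c1; split; trivial; now exists cs.
  - intros [c1 [H1 [cs [H2 H3]]]]; exists (c1 :: cs); rewrite last_cons; simpl; auto.
Qed.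

Lemma halts_within_step A M c m :
  (forall c', step A M c c' -> halts_within A M c' m) -> halts_within A M c (S m).
Proof.
  intros H [|c1 cs]; simpl; [lia|]. intros [H1 H2]; apply (H c1 H1) in H2; lia.
Qed.

Lemma halts_within_le A M c m n : m <= n -> halts_within A M c m -> halts_within A M c n.
Proof. intros H Hc cs Hcs; apply Hc in Hcs; lia. Qed.

Lemma drun_accepts A M n c c' :
  drun A M n c c' -> (accepts_from A M c <-> accepts_from A M c').
Proof.
  intros R; induction R as [m c|m c c1 c' H1 H2 _ IH]; [tauto|].
  rewrite <- IH, accepts_from_step by now apply step_not_acc in H1.
  split; [intros [c2 [H3 H4]]; now rewrite <- (H2 c2)|eauto].
Qed.

Lemma drun_halts A M n c c' m :
  drun A M n c c' -> halts_within A M c' m -> halts_within A M c (n + m).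
Proof.
  intros R; revert m; induction R as [n c|n c c1 c' H1 H2 _ IH]; intros m H.
  - intros cs Hcs; apply H in Hcs; lia.
  - apply halts_within_step; intros c2 Hc; rewrite (H2 c2 Hc); now apply IH.
Qed.

Lemma drun_space A M n c c' s :
  drun A M n c c' -> space_within A M c' s -> space c + 2 * n <= s -> space_within A M c s.
Proof.
  intros R; induction R as [n c|n c c1 c' H1 H2 _ IH]; intros H Hs; trivial.
  intros [|c2 cs]; [simpl; lia|]. intros [H3 H4]; rewrite last_cons.
  rewrite (H2 c2 H3) in *; apply IH; trivial. apply step_space in H1; lia.
Qed.

Lemma drun_unambiguous A M n c c' :
  drun A M n c c' -> unambiguous_from A M c' -> unambiguous_from A M c.
Proof.
  intros R; induction R as [n c|n c c1 c' H1 H2 _ IH]; intros H; trivial.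
  intros [|d1 cs1] [|d2 cs2] Hc1 Ha1 Hc2 Ha2; trivial.
  - now apply step_not_acc in H1.
  - now apply step_not_acc in H1.
  - rewrite last_cons in Ha1, Ha2; destruct Hc1 as [Hs1 Hc1], Hc2 as [Hs2 Hc2].
    apply H2 in Hs1, Hs2; subst; f_equal; now apply (IH H).
Qed.

Lemma stuck_space A M c s :
  (forall c', ~ step A M c c') -> space c <= s -> space_within A M c s.
Proof. intros H Hs [|c' cs]; [trivial|]. intros [H1 _]; now apply H in H1. Qed.

Definition next_config (l r : list sym) (w : word) (act : action) : config :=
  match act with (q', b, d, o) =>
    {| c_state := q'; c_left := fst (move_tape l r b d); c_right := snd (move_tape l r b d);
       c_oracle := match o with None => w | Some bit => w ++ [bit] end |}
  end.

Section Table.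

Context (A : language) (Q : nat) (delta : nat -> sym -> list action) (qs qa qq qy qn : nat).

Let M := {| trans := table Q delta; q_start := qs; q_acc := qa; q_query := qq;
            q_yes := qy; q_no := qn |}.

Lemma table_step q l r w c' :
  q <> qa -> q <> qq -> q < Q ->
  (step A M {| c_state := q; c_left := l; c_right := r; c_oracle := w |} c' <->
   exists act, In act (delta q (hd None r)) /\ c' = next_config l r w act).
Proof.
  intros Hqa Hqq HQ; split.
  - intros H; inversion H; subst; simpl in *; try tauto.
    apply in_table in H2 as (q' & a & act & _ & Ha & ->).
    destruct act as [[[q1 b] d] o]; simpl in H3; injection H3 as -> ->.
    exists (q1, b, d, o); split; trivial; now destruct r.
  - intros [act [Ha ->]].
    set (c := {| c_state := q; c_left := l; c_right := r; c_oracle := w |}).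
    replace (next_config l r w act) with (apply_trans c (make_transition q (hd None r) act))
      by now destruct act as [[[q1 b] d] o].
    apply step_trans; trivial.
    + apply in_table; now exists q, (hd None r), act.
    + destruct act as [[[q1 b] d] o]; simpl; unfold head_sym; now destruct r.
Qed.

Lemma table_drun n q l r w act c' :
  delta q (hd None r) = [act] -> q <> qa -> q <> qq -> q < Q ->
  drun A M n (next_config l r w act) c' ->
  drun A M (S n) {| c_state := q; c_left := l; c_right := r; c_oracle := w |} c'.
Proof.
  intros E H1 H2 H3 R; apply drun_step with (next_config l r w act); trivial.
  - apply table_step; trivial; exists act; rewrite E; simpl; auto.
  - intros c2 H; apply table_step in H; trivial. destruct H as [a [Ha ->]].
    rewrite E in Ha; destruct Ha as [->|[]]; trivial.
Qed.

Lemma table_query n l r w c' (q : bool) :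
  qq <> qa -> (if q then A w else ~ A w) ->
  drun A M n {| c_state := if q then qy else qn; c_left := l; c_right := r; c_oracle := [] |} c' ->
  drun A M (S n) {| c_state := qq; c_left := l; c_right := r; c_oracle := w |} c'.
Proof.
  intros Hqa Hq R; eapply drun_step; [| |exact R].
  - destruct q.
    + now apply (step_query_yes A M {| c_state := qq; c_left := l; c_right := r; c_oracle := w |}).
    + now apply (step_query_no A M {| c_state := qq; c_left := l; c_right := r; c_oracle := w |}).
  - intros c2 H; inversion H; subst; simpl in *; try tauto; destruct q; tauto.
Qed.

Lemma table_accepting l r w :
  accepts_from A M {| c_state := qa; c_left := l; c_right := r; c_oracle := w |} /\
  forall m, halts_within A M {| c_state := qa; c_left := l; c_right := r; c_oracle := w |} m.
Proof.
  split; [now exists []|]. intros m [|c cs]; simpl; [lia|].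
  intros [H _]; now apply step_not_acc in H.
Qed.

Lemma table_stuck q l r w :
  delta q (hd None r) = [] -> q <> qa -> q <> qq ->
  ~ accepts_from A M {| c_state := q; c_left := l; c_right := r; c_oracle := w |} /\
  forall m, halts_within A M {| c_state := q; c_left := l; c_right := r; c_oracle := w |} m.
Proof.
  intros E H1 H2.
  assert (Hno : forall c', ~ step A M {| c_state := q; c_left := l; c_right := r; c_oracle := w |} c').
  { intros c' H; inversion H; subst; simpl in *; try tauto.
    apply in_table in H4 as (q' & a & act & _ & Ha & ->).
    destruct act as [[[q1 b] d] o]; simpl in H5; injection H5 as -> ->.
    unfold head_sym in Ha; destruct r; simpl in *; rewrite E in Ha; tauto. }
  split.
  - rewrite accepts_from_step by trivial; intros [c' [H _]]; now apply Hno in H.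
  - intros m [|c cs]; simpl; [lia|]. intros [H _]; now apply Hno in H.
Qed.

End Table.

(** * Recognizing the diagonal languages *)

(** From [4 + t] down to 4 the tag is written; 3 guesses one bit per input cell and then passes to
    the query state 0. In [witness_machine] the positive answer is the accepting state, the negative
    one is stuck. *)
Definition witness_delta (q : nat) (a : sym) : list action :=
  match q, a with
  | 3, Some b => [(3, Some b, MoveR, Some true); (3, Some b, MoveR, Some false)]
  | 3, None => [(0, None, Stay, None)]
  | 4, _ => [(3, a, Stay, Some false)]
  | S (S (S (S (S j)))), _ => [(4 + j, a, Stay, Some true)]
  | _, _ => []
  end.

Definition witness_machine (t : nat) : OTM :=
  {| trans := table (5 + t) witness_delta; q_start := 4 + t; q_acc := 1; q_query := 0;
     q_yes := 1; q_no := 2 |}.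

(** The rest [e] of the tape may change, since on empty input writing a blank creates an explicit
    cell. *)
Lemma witness_prefix A t j l x e w :
  j <= t -> hd None e = None -> exists e', hd None e' = None /\
  drun A (witness_machine t) (S j)
    {| c_state := 4 + j; c_left := l; c_right := map Some x ++ e; c_oracle := w |}
    {| c_state := 3; c_left := l; c_right := map Some x ++ e'; c_oracle := w ++ tagged j [] |}.
Proof.
  revert e w; induction j as [|j IH]; intros e w Hj He.
  - exists (match x with [] => None :: tl e | _ => e end); split; [now destruct x|].
    eapply table_drun; [reflexivity|lia..|]; destruct x; simpl; rewrite ?He; constructor.
  - destruct (IH (match x with [] => None :: tl e | _ => e end) (w ++ [true])) as (e' & He' & R);
      [lia|now destruct x|].
    exists e'; split; trivial.
    eapply table_drun; [reflexivity|lia..|].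
    replace (w ++ tagged (S j) []) with ((w ++ [true]) ++ tagged j [])
      by (now rewrite <- app_assoc).
    destruct x; simpl in *; rewrite ?He; exact R.
Qed.

(** Each guessed word determines exactly one path, so accepting paths correspond to witnesses. *)
Lemma witness_guess A t x l e w :
  hd None e = None ->
  let c := {| c_state := 3; c_left := l; c_right := map Some x ++ e; c_oracle := w |} in
  let M := witness_machine t in
  halts_within A M c (length x + 2) /\
  (accepts_from A M c <-> exists y, length y = length x /\ A (w ++ y)) /\
  ((forall y y', length y = length x -> length y' = length x ->
      A (w ++ y) -> A (w ++ y') -> y = y') -> unambiguous_from A M c).
Proof.
  intros He; simpl; revert l w; induction x as [|b x IH]; intros l w.
  - assert (R : drun A (witness_machine t) 2
      {| c_state := 3; c_left := l; c_right := e; c_oracle := w |}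
      {| c_state := if excluded_middle_informative (A w) then 1 else 2;
         c_left := l; c_right := None :: tl e; c_oracle := [] |}).
    { eapply table_drun; [rewrite He; reflexivity|lia..|].
      eapply table_query; [lia| |].
      2: { instantiate (1 := if excluded_middle_informative (A w) then true else false).
           destruct (excluded_middle_informative (A w)); constructor. }
      now destruct (excluded_middle_informative (A w)). }
    simpl; split; [|split].
    + apply (drun_halts A _ 2 _ _ 0 R).
      destruct (excluded_middle_informative (A w)).
      * now apply table_accepting.
      * now apply table_stuck.
    + rewrite (drun_accepts A _ _ _ _ R).
      destruct (excluded_middle_informative (A w)) as [H|H].
      * split; [exists []; now rewrite app_nil_r|intros _; apply table_accepting].
      * split; [intros H'; now apply table_stuck in H'|].
        intros [[|] [Hy Hw]]; [now rewrite app_nil_r in Hw|discriminate].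
    + intros _; apply (drun_unambiguous A _ _ _ _ R).
      destruct (excluded_middle_informative (A w)) as [H|H].
      * intros [|c1 cs1] [|c2 cs2] H1 _ H2 _; trivial.
        -- destruct H2 as [H2 _]; now apply step_not_acc in H2.
        -- destruct H1 as [H1 _]; now apply step_not_acc in H1.
        -- destruct H1 as [H1 _]; now apply step_not_acc in H1.
      * intros cs1 cs2 H1 H2; exfalso. revert H2.
        assert (Hno : ~ accepts_from A (witness_machine t)
          {| c_state := 2; c_left := l; c_right := None :: tl e; c_oracle := [] |})
          by now apply table_stuck.
        intros H2; apply Hno; now exists cs1.
  - set (c := {| c_state := 3; c_left := l; c_right := map Some (b :: x) ++ e; c_oracle := w |}).
    set (c' := fun g : bool => {| c_state := 3; c_left := Some b :: l; c_right := map Some x ++ e;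
      c_oracle := w ++ [g] |}).
    assert (Hs : forall d, step A (witness_machine t) c d <-> exists g, d = c' g).
    { intros d; unfold c, witness_machine; rewrite table_step by lia; simpl; split.
      - intros [act [[<-|[<-|[]]] ->]]; [now exists true|now exists false].
      - intros [[] ->]; [exists (3, Some b, MoveR, Some true)|exists (3, Some b, MoveR, Some false)];
        auto. }
    assert (Hacc : forall g, accepts_from A (witness_machine t) (c' g) <->
      exists y, length y = length x /\ A (w ++ g :: y)).
    { intros g; destruct (IH (Some b :: l) (w ++ [g])) as (_ & H & _).
      unfold c'; rewrite H; split; intros [y [Hy1 Hy2]]; exists y; rewrite <- app_assoc in *; auto. }
    split; [|split].
    + apply halts_within_step; intros d Hd; apply Hs in Hd as [g ->]; apply IH.
    + rewrite accepts_from_step by (simpl; lia); split.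
      * intros [d [Hd Hd']]; apply Hs in Hd as [g ->]; apply Hacc in Hd' as [y [Hy1 Hy2]].
        exists (g :: y); simpl; auto.
      * intros [[|g y] [Hy1 Hy2]]; [discriminate|]. exists (c' g); split; [apply Hs; eauto|].
        apply Hacc; exists y; auto.
    + intros Hu [|d1 cs1] [|d2 cs2] H1 E1 H2 E2; trivial; try discriminate.
      rewrite last_cons in E1, E2; destruct H1 as [H1 H1'], H2 as [H2 H2'].
      apply Hs in H1 as [g1 ->]; apply Hs in H2 as [g2 ->].
      destruct (proj1 (Hacc g1)) as (y1 & Hy1 & HA1); [now exists cs1|].
      destruct (proj1 (Hacc g2)) as (y2 & Hy2 & HA2); [now exists cs2|].
      (* Both first guesses extend to witnesses, which coincide by uniqueness. *)
      assert (E : g1 :: y1 = g2 :: y2) by (apply Hu; simpl; auto).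
      injection E as <- _; f_equal.
      destruct (IH (Some b :: l) (w ++ [g1])) as (_ & _ & H); eapply H; eauto.
      intros y y' Hy Hy' Ha Ha'; rewrite <- app_assoc in *; simpl in *.
      assert (E : g1 :: y = g1 :: y') by (apply Hu; simpl; auto). now injection E.
Qed.

Lemma has_witness_UP A N :
  (forall y y', length y = length y' -> A (diag_word N y) -> A (diag_word N y') -> y = y') ->
  UP A (fun x => has_witness N A (length x)).
Proof.
  intros Hu; set (t := 2 * machine_code N + 1); exists (witness_machine t), (fun n => t + n + 3).
  assert (Hx : forall x, exists e', hd None e' = None /\
    drun A (witness_machine t) (S t) (init (witness_machine t) x)
    {| c_state := 3; c_left := []; c_right := map Some x ++ e'; c_oracle := tagged t [] |}).
  { intros x; destruct (witness_prefix A t t [] x [] []) as (e' & He' & R); trivial.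
    exists e'; split; trivial. now rewrite app_nil_r in R. }
  assert (Ht : forall y, tagged t [] ++ y = diag_word N y).
  { intros y; unfold tagged, diag_word; rewrite <- app_assoc; reflexivity. }
  repeat split.
  - apply poly_dominated.
    repeat apply dominated_add; try apply dominated_const; apply dominated_id.
  - intros x cs Hcs; destruct (Hx x) as (e & He & R).
    destruct (witness_guess A t x [] e (tagged t []) He) as (H & _).
    apply (drun_halts _ _ _ _ _ _ R H) in Hcs; lia.
  - intros x cs1 cs2 [H1 H2] [H3 H4]; destruct (Hx x) as (e & He & R).
    destruct (witness_guess A t x [] e (tagged t []) He) as (_ & _ & H).
    eapply (drun_unambiguous _ _ _ _ _ R); eauto.
    apply H; intros y y' Hy Hy'; rewrite !Ht; apply Hu; congruence.
  - intros [y [Hy1 Hy2]]; destruct (Hx x) as (e & He & R).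
    destruct (witness_guess A t x [] e (tagged t []) He) as (_ & H & _).
    apply (drun_accepts _ _ _ _ _ R), H; exists y; now rewrite Ht.
  - intros Ha; destruct (Hx x) as (e & He & R).
    destruct (witness_guess A t x [] e (tagged t []) He) as (_ & H & _).
    apply (drun_accepts _ _ _ _ _ R), H in Ha as [y Hy]; rewrite Ht in Hy; now exists y.
Qed.

(** * Searching for a witness *)

Section Search.

Context (A : language) (t : nat) (guess : bool).

(* States 0-2 shift the input to the right, freeing the first cell as a left end marker;
   3, 4 and 18 append a symbol to the candidate; 5, 6 and 12 return to the marker; from 20 + t
   on, through 7-9, the tag and the tape are copied to the oracle tape.  The last symbol of the
   candidate is true while its length is being compared with the threshold and false afterwards.
   It tells 15 and 16 what a positive or a negative answer means, since a machine has a single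
   query state.  In 12 the candidate is guessed if [guess] holds; otherwise 17 decrements it as
   a binary number after each negative answer. *)
Definition search_delta (q : nat) (a : sym) : list action :=
  match q, a with
  | 0, Some b => [(if b then 1 else 2, None, MoveR, None)]
  | 0, None => [(3, None, MoveR, None)]
  | 1, Some b => [(if b then 1 else 2, Some true, MoveR, None)]
  | 1, None => [(3, Some true, MoveR, None)]
  | 2, Some b => [(if b then 1 else 2, Some false, MoveR, None)]
  | 2, None => [(3, Some false, MoveR, None)]
  | 3, None => [(4, None, MoveR, None)]
  | 4, None => [(18, Some true, MoveR, None)]
  | 5, Some b => [(5, Some b, MoveL, None)]
  | 5, None => [(6, None, MoveL, None)]
  | 6, Some b => [(6, Some b, MoveL, None)]
  | 6, None => [(20 + t, None, Stay, None)]
  | 7, Some b => [(8, Some b, Stay, Some true)]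
  | 7, None => [(9, None, MoveR, Some false)]
  | 8, Some b => [(7, Some b, MoveR, Some b)]
  | 9, Some b => [(9, Some b, MoveR, Some b)]
  | 9, None => [(10, None, Stay, None)]
  | 12, Some b => if guess then [(12, Some true, MoveL, None); (12, Some false, MoveL, None)]
                  else [(12, Some b, MoveL, None)]
  | 12, None => [(6, None, MoveL, None)]
  | 13, None => [(15, None, MoveL, None)]
  | 14, None => [(16, None, MoveL, None)]
  | 15, Some true => [(12, Some false, MoveL, None)]
  | 15, Some false => [(11, Some false, Stay, None)]
  | 16, Some true => [(4, Some true, MoveR, None)]
  | 16, Some false => if guess then [] else [(17, Some false, MoveL, None)]
  | 17, Some false => [(17, Some true, MoveL, None)]
  | 17, Some true => [(5, Some false, MoveL, None)]
  | 18, None => [(5, None, MoveL, None)]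
  | 20, None => [(7, None, MoveR, Some false)]
  | S j, None => if j <? 20 then [] else [(j, None, Stay, Some true)]
  | _, _ => []
  end.

Definition search_machine : OTM :=
  {| trans := table (21 + t) search_delta; q_start := 0; q_acc := 11; q_query := 10;
     q_yes := 13; q_no := 14 |}.

Definition conf (q : nat) (l r : list sym) (w : word) : config :=
  {| c_state := q; c_left := l; c_right := r; c_oracle := w |}.

Notation run := (drun A search_machine).
Notation bits := (map Some).

Lemma run_step n q l r w act c' :
  search_delta q (hd None r) = [act] -> q <> 11 -> q <> 10 -> q < 21 + t ->
  run n (next_config l r w act) c' -> run (S n) (conf q l r w) c'.
Proof. apply table_drun. Qed.

Ltac go := eapply run_step; [reflexivity|lia|lia|lia|cbn [next_config move_tape fst snd tl]].

Lemma move_left q v a l r (b : bool) w :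
  (forall b, search_delta q (Some b) = [(q, Some b, MoveL, None)]) ->
  q <> 11 -> q <> 10 -> q < 21 + t ->
  run (length v + 1) (conf q (bits v ++ a :: l) (Some b :: r) w)
    (conf q l (a :: bits (rev v) ++ Some b :: r) w).
Proof.
  intros Hq H1 H2 H3; revert r b; induction v as [|c v IH]; intros r b.
  - eapply run_step; [apply Hq|trivial..|constructor].
  - eapply run_step; [apply Hq|trivial..|].
    specialize (IH (Some b :: r) c); simpl rev; rewrite map_app, <- !app_assoc; exact IH.
Qed.

Lemma shift (b : bool) x l :
  run (length x + 1) (conf (if b then 1 else 2) l (bits x) [])
    (conf 3 (bits (rev (b :: x)) ++ l) [] []).
Proof.
  revert b l; induction x as [|c x IH]; intros b l.
  - destruct b; go; constructor.
  - assert (E : bits (rev (b :: c :: x)) ++ l = bits (rev (c :: x)) ++ Some b :: l).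
    { simpl; rewrite !map_app, <- !app_assoc; reflexivity. }
    rewrite E; destruct b; go; apply IH.
Qed.

Lemma start_run x :
  run (length x + 2) (init search_machine x) (conf 4 (None :: bits (rev x) ++ [None]) [] []).
Proof.
  change (init search_machine x) with (conf 0 [] (bits x) []).
  assert (H3 : run 1 (conf 3 (bits (rev x) ++ [None]) [] [])
                 (conf 4 (None :: bits (rev x) ++ [None]) [] [])) by (go; constructor).
  replace (length x + 2) with (S (length x) + 1) by lia; eapply drun_trans; [|exact H3].
  destruct x as [|b x]; [go; constructor|].
  go; replace (length (b :: x)) with (length x + 1) by (simpl; lia); apply shift.
Qed.

(** Tape at the start of every sweep: left marker, input, separator, candidate with its flag bit,
    blank. *)
Definition sweep_start (x u : word) : config :=
  conf (20 + t) [] (None :: bits x ++ None :: bits u ++ [None]) [].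

Lemma write_tag j r w :
  j <= t ->
  run (j + 1) (conf (20 + j) [] (None :: r) w) (conf 7 [None] r (w ++ tagged j [])).
Proof.
  revert w; induction j as [|j IH]; intros w Hj; [go; constructor|].
  eapply run_step; [reflexivity|lia|lia|lia|].
  replace (w ++ tagged (S j) []) with ((w ++ [true]) ++ tagged j [])
    by (now rewrite <- app_assoc).
  apply IH; lia.
Qed.

Lemma write_input x l r w :
  run (2 * length x + 1) (conf 7 l (bits x ++ None :: r) w)
    (conf 9 (None :: bits (rev x) ++ l) r (w ++ doubled x ++ [false])).
Proof.
  revert l w; induction x as [|b x IH]; intros l w; [go; constructor|].
  replace (2 * length (b :: x) + 1) with (S (S (2 * length x + 1))) by (simpl; lia).
  go; go. specialize (IH (Some b :: l) ((w ++ [true]) ++ [b])).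
  simpl rev; simpl doubled; rewrite map_app, <- !app_assoc.
  rewrite <- !app_assoc in IH; exact IH.
Qed.

Lemma write_candidate u l w :
  run (length u + 1) (conf 9 l (bits u ++ [None]) w) (conf 10 (bits (rev u) ++ l) [None] (w ++ u)).
Proof.
  revert l w; induction u as [|b u IH]; intros l w.
  - rewrite app_nil_r; go; constructor.
  - go. specialize (IH (Some b :: l) (w ++ [b])).
    simpl rev; rewrite map_app, <- !app_assoc; rewrite <- !app_assoc in IH; exact IH.
Qed.

(** After the answer the head is back on the flag [f], ready for 15 or 16 to inspect it. *)
Lemma query_run (x z : word) (f q : bool) :
  (if q then A (instance_word t x (z ++ [f])) else ~ A (instance_word t x (z ++ [f]))) ->
  run (t + 2 * length x + length z + 6) (sweep_start x (z ++ [f]))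
    (conf (if q then 15 else 16) (bits (rev z) ++ None :: bits (rev x) ++ [None])
       [Some f; None] []).
Proof.
  intros Hq.
  replace (t + 2 * length x + length z + 6)
    with ((t + 1) + ((2 * length x + 1) + ((length z + 2) + 2))) by lia.
  eapply drun_trans; [now apply write_tag|].
  eapply drun_trans; [apply write_input|].
  replace (length z + 2) with (length (z ++ [f]) + 1) by (rewrite length_app; simpl; lia).
  eapply drun_trans; [apply write_candidate|].
  rewrite rev_app_distr.
  assert (E : (([] ++ tagged t []) ++ doubled x ++ [false]) ++ z ++ [f] =
              instance_word t x (z ++ [f])).
  { unfold instance_word, tagged; rewrite <- !app_assoc; simpl; rewrite <- ?app_assoc; reflexivity. }
  rewrite E. eapply table_query; [lia|exact Hq|]. destruct q; go; constructor.
Qed.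

Lemma return_from_separator q v r :
  search_delta q None = [(6, None, MoveL, None)] -> q <> 11 -> q <> 10 -> q < 21 + t ->
  run (length v + 2) (conf q (bits v ++ [None]) (None :: r) [])
    (conf (20 + t) [] (None :: bits (rev v) ++ None :: r) []).
Proof.
  intros Hq H1 H2 H3; replace (length v + 2) with ((length v + 1) + 1) by lia.
  eapply drun_trans with (conf 6 [] (None :: bits (rev v) ++ None :: r) []); [|go; constructor].
  destruct v as [|b v]; [eapply run_step; [exact Hq|trivial..|constructor]|].
  eapply run_step; [exact Hq|trivial..|].
  simpl rev; rewrite map_app, <- !app_assoc.
  replace (length (b :: v) + 0) with (length v + 1) by (simpl; lia).
  apply move_left; trivial; lia.
Qed.

(** The state [q] is general because both 5 and, when [guess] is false, 12 walk back to the marker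
    in this way. *)
Lemma return_run q v x p d r :
  (forall b, search_delta q (Some b) = [(q, Some b, MoveL, None)]) ->
  search_delta q None = [(6, None, MoveL, None)] -> q <> 11 -> q <> 10 -> q < 21 + t ->
  search_delta p (hd None r) = [(q, d, MoveL, None)] ->
  p <> 11 -> p <> 10 -> p < 21 + t ->
  run (length v + length x + 3)
    (conf p (bits v ++ None :: bits (rev x) ++ [None]) r [])
    (conf (20 + t) [] (None :: bits x ++ None :: bits (rev v) ++ d :: tl r) []).
Proof.
  intros Hq Hq' Hq1 Hq2 Hq3 Hp H1 H2 H3.
  replace (length v + length x + 3) with ((length v + 1) + (length x + 2)) by lia.
  assert (H := fun r => return_from_separator q (rev x) r Hq' Hq1 Hq2 Hq3).
  rewrite length_rev, rev_involutive in H.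
  eapply drun_trans; [|apply H].
  destruct v as [|b v].
  - eapply run_step; [exact Hp|trivial..|]. constructor.
  - eapply run_step; [exact Hp|trivial..|].
    simpl rev; rewrite map_app, <- !app_assoc.
    replace (length (b :: v) + 0) with (length v + 1) by (simpl; lia).
    apply move_left; trivial.
Qed.

(** The tape under the head is unwritten the first time and holds one blank afterwards. *)
Lemma extend_run r x z :
  r = [] \/ r = [None] ->
  run (length z + length x + 5) (conf 4 (bits (rev z) ++ None :: bits (rev x) ++ [None]) r [])
    (sweep_start x (z ++ [true])).
Proof.
  intros Hr; replace (length z + length x + 5) with (S (length (true :: rev z) + length x + 3))
    by (simpl; rewrite length_rev; lia).
  eapply run_step; [destruct Hr as [-> | ->]; reflexivity|lia|lia|lia|].
  assert (H := return_run 5 (true :: rev z) x 18 None []).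
  simpl rev in H; rewrite rev_involutive in H; unfold sweep_start; rewrite map_app, <- app_assoc in *.
  destruct Hr as [-> | ->]; apply H; trivial; lia.
Qed.

Context (x : word) (B : nat).
Context (clock : forall z, A (instance_word t x (z ++ [true])) <-> B <= length z).

(** Each negative clock answer lengthens the candidate by one [true], so [B] is found in unary. The
    positive query that ends this phase is left to the two searches. *)
Lemma clock_run :
  run ((B + 1) * (t + 4 * length x + 3 * B + 20)) (init search_machine x)
    (sweep_start x (repeat true B ++ [true])).
Proof.
  assert (H : forall b, b <= B -> run ((b + 1) * (t + 4 * length x + 3 * B + 20))
    (init search_machine x) (sweep_start x (repeat true b ++ [true]))).
  { induction b as [|b IH]; intros Hb.
    - apply (drun_le _ _ ((length x + 2) + (length x + 5))); [lia|].
      eapply drun_trans; [apply start_run|]. apply (extend_run [] x []); auto.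
    - replace ((S b + 1) * (t + 4 * length x + 3 * B + 20))
        with ((b + 1) * (t + 4 * length x + 3 * B + 20) + (t + 4 * length x + 3 * B + 20)) by lia.
      eapply drun_trans; [apply IH; lia|].
      apply (drun_le _ _ ((t + 2 * length x + b + 6) + S (S b + length x + 5))); [lia|].
      eapply drun_trans.
      + rewrite <- (repeat_length true b) at 1; apply (query_run x _ true false).
        rewrite clock, repeat_length; lia.
      + go. change (repeat true (S b)) with (true :: repeat true b); rewrite repeat_cons.
        assert (H := extend_run [None] x (repeat true b ++ [true])).
        rewrite length_app, repeat_length, rev_app_distr in H.
        apply (drun_le _ _ (b + 1 + length x + 5)); [lia|]. apply H; auto. }
  now apply H.
Qed.

Lemma final_query z :
  let c := sweep_start x (z ++ [false]) in
  (A (instance_word t x (z ++ [false])) ->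
    exists l r w, run (t + 2 * length x + length z + 7) c (conf 11 l r w)) /\
  (~ A (instance_word t x (z ++ [false])) ->
    run (t + 2 * length x + length z + 7) c
      (conf 16 (bits (rev z) ++ None :: bits (rev x) ++ [None]) [Some false; None] [])).
Proof.
  split; intros H.
  - do 3 eexists; apply (drun_le _ _ ((t + 2 * length x + length z + 6) + 1)); [lia|].
    eapply drun_trans; [apply (query_run x z false true), H|]. go; constructor.
  - apply (drun_le _ _ (t + 2 * length x + length z + 6)); [lia|].
    apply (query_run x z false false), H.
Qed.

Lemma accepting_no_step l r w c : ~ step A search_machine (conf 11 l r w) c.
Proof. intros H; now apply step_not_acc in H. Qed.

End Search.

(** * Binary counting on the candidate *)

Fixpoint value (v : word) : nat :=
  match v with [] => 0 | b :: v' => (if b then 1 else 0) + 2 * value v' end.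

Lemma value_inj v v' : length v = length v' -> value v = value v' -> v = v'.
Proof.
  revert v'; induction v as [|b v IH]; intros [|b' v']; simpl; trivial; try discriminate.
  intros Hl Hv; assert (E : v = v') by (apply IH; destruct b, b'; lia).
  subst; f_equal; destruct b, b'; trivial; lia.
Qed.

Lemma value_false n : value (repeat false n) = 0.
Proof. induction n as [|n IH]; simpl; lia. Qed.

Lemma value_true v : value v <= value (repeat true (length v)).
Proof. induction v as [|[] v IH]; simpl; lia. Qed.

Lemma value_decrement k v :
  value (repeat false k ++ true :: v) = S (value (repeat true k ++ false :: v)).
Proof. induction k as [|k IH]; simpl in *; lia. Qed.

Lemma lowest_true v : v = repeat false (length v) \/ exists k v', v = repeat false k ++ true :: v'.
Proof.
  induction v as [|[] v [IH|(k & v' & IH)]]; simpl; auto.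
  - right; now exists 0, v.
  - right; now exists 0, v.
  - left; congruence.
  - right; exists (S k), v'; simpl; congruence.
Qed.

Lemma drun_space_stuck A M n c c' s :
  drun A M n c c' -> (forall d, ~ step A M c' d) -> space c + 2 * n <= s ->
  space_within A M c s.
Proof.
  intros R Hno Hs.
  assert (Hc : space c' <= space c + 2 * n).
  { clear Hs; induction R as [n c|n c c1 c' H1 H2 _ IH]; [lia|].
    apply step_space in H1; specialize (IH Hno); lia. }
  apply (drun_space A M n c c'); trivial. apply stuck_space; trivial; lia.
Qed.

Section Deterministic.

Context (A : language) (t : nat).

Notation run := (drun A (search_machine t false)).
Notation bits := (map Some).

(** The borrow turns low [false] bits into [true]. It is started by [p = 16], and the induction
    continues it with [p = 17]. *)
Lemma decrement_run k p l a d r :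
  search_delta t false p (hd None r) = [(17, d, MoveL, None)] ->
  p <> 11 -> p <> 10 -> p < 21 + t ->
  run (k + 1) (conf p (bits (repeat false k) ++ a :: l) r [])
    (conf 17 l (a :: bits (repeat true k) ++ d :: tl r) []).
Proof.
  revert p r d; induction k as [|k IH]; intros p r d Hp H1 H2 H3.
  - eapply run_step; [exact Hp|trivial..|constructor].
  - eapply run_step; [exact Hp|trivial..|].
    change (repeat true (S k)) with (true :: repeat true k); rewrite repeat_cons, map_app, <- app_assoc.
    apply (IH 17 (Some false :: d :: tl r) (Some true)); trivial; lia.
Qed.

Context (x : word).

(** The tape holds [rev v], with the low bit next to the flag where the decrement begins. Every
    sweep starts on a tape of the same size and takes a bounded number of steps, so [s] does not
    depend on the exponentially large number of sweeps. *)
Lemma enumeration v s :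
  2 * (t + 5 * length x + 4 * length v + 30) <= s ->
  let c := sweep_start t x (rev v ++ [false]) in
  (accepts_from A (search_machine t false) c <->
   exists v', length v' = length v /\ value v' <= value v /\
     A (instance_word t x (rev v' ++ [false]))) /\
  space_within A (search_machine t false) c s.
Proof.
  intros Hs; simpl; remember (value v) as n eqn:Hn; revert v Hn Hs.
  induction n as [n IH] using lt_wf_ind; intros v Hn Hs.
  set (c := sweep_start t x (rev v ++ [false])).
  assert (Hc : space c = length x + length v + 4).
  { unfold space, c, sweep_start, conf; simpl.
    repeat rewrite ?length_app, ?length_map, ?length_rev; simpl.
    repeat rewrite ?length_app, ?length_map, ?length_rev; simpl; lia. }
  destruct (final_query A t false x (rev v)) as [Hyes Hno].
  rewrite length_rev, rev_involutive in *; fold c in Hyes, Hno.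
  destruct (classic (A (instance_word t x (rev v ++ [false])))) as [HA|HA].
  - destruct (Hyes HA) as (l & r & w & R); split.
    + rewrite (drun_accepts _ _ _ _ _ R); split.
      * intros _; exists v; repeat split; trivial; lia.
      * intros _; apply table_accepting.
    + eapply drun_space_stuck; [exact R|intros d; apply accepting_no_step|lia].
  - specialize (Hno HA); destruct (lowest_true v) as [E|(k & v' & E)].
    (* The candidate is zero: the borrow reaches the separator, where 17 is stuck, and the search
       rejects. *)
    + assert (R : run (t + 2 * length x + length v + 7 + (length v + 1)) c
        (conf 17 (bits (rev x) ++ [None]) (None :: bits (repeat true (length v)) ++ [Some false; None]) [])).
      { eapply drun_trans; [exact Hno|]. rewrite E at 2.
        apply (decrement_run (length v) 16 _ None (Some false) [Some false; None]); trivial; lia. }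
      assert (Hstuck : forall d, ~ step A (search_machine t false)
        (conf 17 (bits (rev x) ++ [None]) (None :: bits (repeat true (length v)) ++ [Some false; None]) []) d).
      { intros d H; apply table_step in H; [|lia..]. simpl in H. now destruct H as [? [[] _]]. }
      split.
      * rewrite (drun_accepts _ _ _ _ _ R); split.
        -- intros H; rewrite accepts_from_step in H by (simpl; lia).
           destruct H as [d [H _]]; now apply Hstuck in H.
        -- intros (v' & H1 & H2 & H3); exfalso; apply HA.
           assert (v' = v) as <-; trivial. apply value_inj; trivial.
           rewrite Hn in H2; rewrite E, value_false in *; lia.
      * eapply drun_space_stuck; [exact R|exact Hstuck|lia].
    + set (v1 := repeat true k ++ false :: v').
      assert (Hl : length v1 = length v)
        by (unfold v1; rewrite E, !length_app, !repeat_length; reflexivity).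
      assert (Hv : value v = S (value v1)) by (rewrite E; apply value_decrement).
      assert (R : run (t + 4 * length x + 3 * length v + 20) c (sweep_start t x (rev v1 ++ [false]))).
      { assert (Hk : length v = k + S (length v'))
          by (rewrite E, length_app, repeat_length; reflexivity).
        apply (drun_le _ _ ((t + 2 * length x + length v + 7) + ((k + 1) + (length v' + length x + 3))));
          [lia|].
        eapply drun_trans; [exact Hno|].
        assert (Ev : bits (rev (rev v)) ++ None :: bits (rev x) ++ [None] =
          bits (repeat false k) ++ Some true :: bits v' ++ None :: bits (rev x) ++ [None])
          by (rewrite rev_involutive, E, map_app, <- app_assoc; reflexivity).
        rewrite rev_involutive in Ev; rewrite Ev.
        eapply drun_trans.
        - apply (decrement_run k 16 _ (Some true) (Some false) [Some false; None]); trivial; lia.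
        - assert (H := return_run A t false 5 v' x 17 (Some false)
            (Some true :: bits (repeat true k) ++ [Some false; None])).
          assert (Eu : bits (rev v1 ++ [false]) ++ [None] =
            bits (rev v') ++ Some false :: bits (repeat true k) ++ [Some false; None]).
          { unfold v1; rewrite rev_app_distr, rev_repeat; simpl.
            repeat rewrite ?map_app, <- ?app_assoc; reflexivity. }
          unfold sweep_start; rewrite Eu; apply H; trivial; lia. }
      destruct (IH (value v1)) with (v := v1) as [IH1 IH2]; [lia|trivial|lia|].
      split.
      * rewrite (drun_accepts _ _ _ _ _ R), IH1; split.
        -- intros (u & H1 & H2 & H3); exists u; repeat split; trivial; lia.
        -- intros (u & H1 & H2 & H3); exists u; repeat split; trivial; [lia|].
           destruct (Nat.eq_dec (value u) (value v)) as [Eu|]; [|lia].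
           apply value_inj in Eu; trivial; subst u; tauto.
      * eapply drun_space; [exact R|exact IH2|lia].
Qed.

Context (B : nat).
Context (clock : forall z, A (instance_word t x (z ++ [true])) <-> B <= length z).

(** The clock phase leaves the candidate of all [true], whose value is the largest, so counting down
    meets every word of length [B]. *)
Lemma deterministic_search :
  (accepts A (search_machine t false) x <->
   exists z, length z = B /\ A (instance_word t x (z ++ [false]))) /\
  space_within A (search_machine t false) (init (search_machine t false) x)
    (2 * ((B + 2) * (t + 5 * length x + 4 * B + 40))).
Proof.
  assert (R : run ((B + 1) * (t + 4 * length x + 3 * B + 20) +
      ((t + 2 * length x + B + 6) + (B + length x + 3)))
    (init (search_machine t false) x) (sweep_start t x (rev (repeat true B) ++ [false]))).
  { eapply drun_trans; [now apply clock_run|].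
    eapply drun_trans.
    - rewrite <- (repeat_length true B) at 1; apply (query_run A t false x _ true true).
      rewrite clock, repeat_length; lia.
    - assert (H := return_run A t false 12 (rev (repeat true B)) x 15 (Some false) [Some true; None]).
      rewrite length_rev, repeat_length, rev_involutive, rev_repeat in H.
      unfold sweep_start; rewrite rev_repeat, map_app, <- app_assoc.
      apply H; trivial; lia. }
  destruct (enumeration (repeat true B) (2 * ((B + 2) * (t + 5 * length x + 4 * B + 40))))
    as [H1 H2].
  { rewrite repeat_length; nia. }
  split.
  - change (accepts A (search_machine t false) x)
      with (accepts_from A (search_machine t false) (init (search_machine t false) x)).
    rewrite (drun_accepts _ _ _ _ _ R), H1, repeat_length; split.
    + intros (v & Hv & _ & HA); exists (rev v); now rewrite length_rev.
    + intros (z & Hz & HA); exists (rev z); rewrite length_rev, rev_involutive.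
      repeat split; trivial. rewrite <- Hz, <- (length_rev z); apply value_true.
  - eapply drun_space; [exact R|exact H2|]. rewrite space_init; nia.
Qed.

End Deterministic.

Section Nondeterministic.

Context (A : language) (t : nat) (x : word).

Notation M := (search_machine t true).
Notation bits := (map Some).

Lemma guess_steps l b r c :
  step A M (conf 12 l (Some b :: r) []) c <->
  exists g, c = next_config l (Some b :: r) [] (12, Some g, MoveL, None).
Proof.
  unfold conf, search_machine; rewrite table_step by lia; simpl; split.
  - intros [act [[<-|[<-|[]]] ->]]; [now exists true|now exists false].
  - intros [[] ->]; eexists; split; [left; reflexivity|reflexivity|right; left; reflexivity|reflexivity].
Qed.

(** Guessing goes from right to left: [y] is already guessed, while [b] and [v] are still to be
    overwritten. *)
Lemma guess_run v y b :
  let c := conf 12 (bits v ++ None :: bits (rev x) ++ [None])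
    (Some b :: bits y ++ [Some false; None]) [] in
  (accepts_from A M c <->
   exists z, length z = length v + 1 /\ accepts_from A M (sweep_start t x ((z ++ y) ++ [false]))) /\
  forall m,
    (forall z, length z = length v + 1 ->
       halts_within A M (sweep_start t x ((z ++ y) ++ [false])) m) ->
    halts_within A M c (m + length v + length x + 4).
Proof.
  revert y b; induction v as [|d v IH]; intros y b.
  - assert (R : forall g, drun A M (length x + 2)
      (next_config (None :: bits (rev x) ++ [None]) (Some b :: bits y ++ [Some false; None]) []
        (12, Some g, MoveL, None))
      (sweep_start t x (([g] ++ y) ++ [false]))).
    { intros g; assert (H := return_from_separator A t true 12 (rev x)
        (Some g :: bits y ++ [Some false; None])).
      rewrite length_rev, rev_involutive in H.
      unfold sweep_start; simpl; rewrite map_app, <- app_assoc; apply H; trivial; lia. }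
    simpl; split.
    + rewrite accepts_from_step by (simpl; lia); split.
      * intros [c' [Hc' Ha]]; apply guess_steps in Hc' as [g ->].
        exists [g]; split; trivial. now rewrite (drun_accepts _ _ _ _ _ (R g)) in Ha.
      * intros [z [Hz Ha]]; destruct z as [|g [|]]; try discriminate.
        eexists; split; [apply guess_steps; exists g; reflexivity|].
        now rewrite (drun_accepts _ _ _ _ _ (R g)).
    + intros m Hm; apply (halts_within_le _ _ _ (S (length x + 2 + m))); [lia|].
      apply halts_within_step; intros c' Hc'; apply guess_steps in Hc' as [g ->].
      apply (drun_halts _ _ _ _ _ _ (R g)), Hm; trivial.
  - assert (E : forall g, next_config (bits (d :: v) ++ None :: bits (rev x) ++ [None])
        (Some b :: bits y ++ [Some false; None]) [] (12, Some g, MoveL, None) =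
      conf 12 (bits v ++ None :: bits (rev x) ++ [None])
        (Some d :: bits (g :: y) ++ [Some false; None]) []) by reflexivity.
    split.
    + rewrite accepts_from_step by (simpl; lia); split.
      * intros [c' [Hc' Ha]]; apply guess_steps in Hc' as [g ->]; rewrite E in Ha.
        apply IH in Ha as (z & Hz & Ha); exists (z ++ [g]).
        rewrite length_app, <- (app_assoc z); simpl; split; [lia|exact Ha].
      * intros [z [Hz Ha]]; destruct (exists_last (l := z)) as (z' & g & ->).
        { intros ->; simpl in Hz; discriminate. }
        eexists; split; [apply guess_steps; exists g; reflexivity|].
        rewrite E; apply IH; exists z'; rewrite length_app in Hz; simpl in Hz; split; [lia|].
        now rewrite <- (app_assoc z') in Ha.
    + intros m Hm; apply (halts_within_le _ _ _ (S (m + length v + length x + 4)));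
        [simpl; lia|].
      apply halts_within_step; intros c' Hc'; apply guess_steps in Hc' as [g ->]; rewrite E.
      apply IH; intros z Hz; assert (H := Hm (z ++ [g])); rewrite <- (app_assoc z) in H.
      apply H; rewrite length_app; simpl; lia.
Qed.

Lemma candidate_result z :
  let c := sweep_start t x (z ++ [false]) in
  (accepts_from A M c <-> A (instance_word t x (z ++ [false]))) /\
  halts_within A M c (t + 2 * length x + length z + 7).
Proof.
  destruct (final_query A t true x z) as [Hyes Hno]; simpl in *.
  destruct (classic (A (instance_word t x (z ++ [false])))) as [HA|HA].
  - destruct (Hyes HA) as (l & r & w & R); split.
    + rewrite (drun_accepts _ _ _ _ _ R); split; [trivial|intros _; apply table_accepting].
    + rewrite <- (Nat.add_0_r (_ + 7)); apply (drun_halts _ _ _ _ _ _ R), table_accepting.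
  - assert (R := Hno HA).
    assert (Hs := table_stuck A (21 + t) (search_delta t true) 0 11 10 13 14 16
      (bits (rev z) ++ None :: bits (rev x) ++ [None]) [Some false; None] []
      eq_refl ltac:(lia) ltac:(lia)).
    split.
    + rewrite (drun_accepts _ _ _ _ _ R); split; [|tauto]. intros H; now apply Hs in H.
    + rewrite <- (Nat.add_0_r (_ + 7)); apply (drun_halts _ _ _ _ _ _ R), Hs.
Qed.

Context (B : nat).
Context (clock : forall z, A (instance_word t x (z ++ [true])) <-> S B <= length z).

(** The threshold has the form [S B] because guessing starts on the last cell of a nonempty
    candidate. *)
Lemma nondeterministic_search :
  (accepts A M x <-> exists z, length z = S B /\ A (instance_word t x (z ++ [false]))) /\
  halts_within A M (init M x) ((B + 4) * (t + 6 * length x + 4 * B + 60)).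
Proof.
  set (c := conf 12 (bits (repeat true B) ++ None :: bits (rev x) ++ [None])
    (Some true :: bits [] ++ [Some false; None]) []).
  assert (R : drun A M ((S B + 1) * (t + 4 * length x + 3 * S B + 20) +
      ((t + 2 * length x + S B + 6) + 1)) (init M x) c).
  { eapply drun_trans; [now apply clock_run|].
    eapply drun_trans.
    - rewrite <- (repeat_length true (S B)) at 1; apply (query_run A t true x _ true true).
      rewrite clock, repeat_length; lia.
    - rewrite rev_repeat. eapply run_step; [reflexivity|lia..|constructor]. }
  destruct (guess_run (repeat true B) [] true) as [H1 H2]; fold c in H1, H2.
  rewrite repeat_length in *.
  split.
  - change (accepts A M x) with (accepts_from A M (init M x)).
    rewrite (drun_accepts _ _ _ _ _ R), H1; split; intros (z & Hz & Ha); exists z;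
    rewrite app_nil_r in *; (split; [lia|]); now apply candidate_result.
  - apply (halts_within_le _ _ _ ((S B + 1) * (t + 4 * length x + 3 * S B + 20) +
      ((t + 2 * length x + S B + 6) + 1) + ((t + 2 * length x + S B + 7) + B + length x + 4)));
      [nia|].
    apply (drun_halts _ _ _ _ _ _ R), H2; intros z Hz; rewrite app_nil_r.
    replace (S B) with (length z) by lia; apply candidate_result.
Qed.

End Nondeterministic.

(** * NP and PSPACE coincide relative to a valid oracle *)

Lemma valid_clock D A M k x z :
  (forall w, D w -> is_diag w) -> valid D A ->
  (A (instance_word (machine_tag M k) x (z ++ [true])) <-> threshold M k x <= length z).
Proof.
  intros HD (H1 & H2 & _); change (instance_word _ _ _) with (clock_word M k x z); split.
  - intros H; apply H1 in H as [(M' & k' & x' & z' & E & H)|[H|H]].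
    + apply clock_word_inj in E as (-> & -> & -> & ->); trivial.
    + apply HD in H as (N & y & E); symmetry in E; now apply diag_not_clock in E.
    + apply true_fact_is_fact in H as (M' & k' & x' & z' & E); symmetry in E.
      now apply fact_not_clock in E.
  - intros H; apply H2; left; now exists M, k, x, z.
Qed.

Lemma valid_claim D A M k x s :
  (forall w, D w -> is_diag w) -> valid D A -> proper M k x s ->
  ((exists z, length z = s /\ A (instance_word (machine_tag M k) x (z ++ [false]))) <->
   accepts_in_space A M x s).
Proof.
  intros HD HA Hp; split.
  - intros (z & <- & H); change (A (fact_word M k x z)) in H.
    apply (valid_fact D) in H as (M' & k' & x' & z' & E & _ & H); trivial.
    + apply fact_word_inj in E as (-> & -> & -> & ->); trivial.
    + now exists M, k, x, z.
  - intros H; now apply HA.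
Qed.

Lemma accepts_in_space_accepts A M x s :
  (forall c, reachable A M x c -> space c <= s) ->
  (accepts A M x <-> accepts_in_space A M x s).
Proof.
  intros Hs; split.
  - intros [cs Hcs]; exists cs; split; trivial; intros c Hc; apply Hs.
    destruct Hc as [<-|Hc]; [now exists []|].
    apply in_split in Hc as (l1 & l2 & ->); exists (l1 ++ [c]).
    destruct Hcs as [Hcs _]; replace (l1 ++ c :: l2) with ((l1 ++ [c]) ++ l2) in Hcs
      by (now rewrite <- app_assoc).
    split; [now apply chain_app in Hcs|now rewrite last_last].
  - intros [cs [Hcs _]]; now exists cs.
Qed.

(** A run of [p n] steps stays in space [n + 2 * p n]. *)
Lemma NP_in_space A L :
  NP A L -> exists M k, forall x s,
    length x ^ k + k <= s -> (L x <-> accepts_in_space A M x s).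
Proof.
  intros (M & p & Hp & Ht & HL).
  assert (Hq : poly_bounded (fun n => n + 2 * p n)).
  { apply poly_dominated, dominated_add; [apply dominated_id|].
    apply dominated_mul; [apply dominated_const|now apply poly_dominated]. }
  destruct Hq as [k Hk]; exists M, k; intros x s Hs.
  rewrite HL; apply accepts_in_space_accepts; intros c (cs & Hcs & <-).
  pose proof (Ht x cs Hcs); pose proof (chain_space A M _ cs Hcs) as H'.
  rewrite space_init in H'; specialize (Hk (length x)); lia.
Qed.

Lemma PSPACE_in_space A L :
  PSPACE A L -> exists M k, forall x s,
    length x ^ k + k <= s -> (L x <-> accepts_in_space A M x s).
Proof.
  intros (M & p & _ & [k Hk] & Ht & HL); exists M, k; intros x s Hs.
  rewrite HL; apply accepts_in_space_accepts; intros c Hc; apply Ht in Hc.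
  specialize (Hk (length x)); lia.
Qed.

Lemma search_deterministic t : deterministic (search_machine t false).
Proof.
  intros t1 t2; apply table_deterministic; intros q a.
  do 21 (destruct q as [|q]; [destruct a as [[]|]; simpl; lia|]).
  destruct a as [[]|]; simpl; lia.
Qed.

Lemma dominated_threshold M k : exists f, dominated f /\ forall x, threshold M k x = f (length x).
Proof.
  exists (fun n => n ^ k + k + n + machine_tag M k + 1); split; [|reflexivity].
  repeat apply dominated_add; try apply dominated_const; try apply dominated_id.
  apply dominated_pow, dominated_id.
Qed.

(** Membership amounts to a witness of length [threshold M k x] in the oracle, which is guessed in
    polynomial time or enumerated in polynomial space. *)
Lemma in_space_NP_PSPACE D A L M k :
  (forall w, D w -> is_diag w) -> valid D A ->
  (forall x s, length x ^ k + k <= s -> (L x <-> accepts_in_space A M x s)) ->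
  NP A L /\ PSPACE A L.
Proof.
  intros HD HA HL; set (t := machine_tag M k).
  assert (Hc : forall x z, A (instance_word t x (z ++ [true])) <-> threshold M k x <= length z)
    by (intros x z; now apply (valid_clock D)).
  assert (HL' : forall x, L x <->
    exists z, length z = threshold M k x /\ A (instance_word t x (z ++ [false]))).
  { intros x; unfold t; rewrite (valid_claim D) by (trivial; unfold proper, threshold; lia).
    apply HL; unfold threshold; lia. }
  destruct (dominated_threshold M k) as (f & Hf & Ef).
  assert (Hpoly : forall a b d e, poly_bounded (fun n => a * ((f n + b) * (t + d * n + 4 * f n + e)))).
  { intros a b d e; apply poly_dominated, dominated_mul; [apply dominated_const|].
    apply dominated_mul; repeat apply dominated_add; trivial; try apply dominated_const;
    apply dominated_mul; trivial; try apply dominated_const; apply dominated_id. }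
  split.
  - exists (search_machine t true), (fun n => 1 * ((f n + 4) * (t + 6 * n + 4 * f n + 60))).
    assert (Hx : forall x, exists B, threshold M k x = S B)
      by (intros x; exists (length x ^ k + k + length x + machine_tag M k); unfold threshold; lia).
    split; [apply Hpoly|split].
    + intros x cs Hcs; destruct (Hx x) as [B HB].
      destruct (nondeterministic_search A t x B) as [_ H].
      { intros z; rewrite <- HB; apply Hc. }
      apply H in Hcs; rewrite <- Ef, HB; nia.
    + intros x; destruct (Hx x) as [B HB].
      destruct (nondeterministic_search A t x B) as [H _].
      { intros z; rewrite <- HB; apply Hc. }
      now rewrite H, HL', HB.
  - exists (search_machine t false), (fun n => 2 * ((f n + 2) * (t + 5 * n + 4 * f n + 40))).
    split; [apply search_deterministic|split; [apply Hpoly|split]].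
    + intros x c (cs & Hcs & <-); rewrite <- Ef.
      destruct (deterministic_search A t x (threshold M k x) (Hc x)) as [_ H]; now apply H.
    + intros x; destruct (deterministic_search A t x (threshold M k x) (Hc x)) as [H _].
      now rewrite H, HL'.
Qed.

Theorem theorem4p1 :
  exists A : language,
    (forall L : language, NP A L <-> PSPACE A L) /\
    ~ (exists C : language, UP A C /\ forall L : language, UP A L -> mreduces A L C).
Proof.
  destruct diagonal_oracle as (A & HA & Hdiag); exists A; split.
  - intros L; split; intros HL.
    + destruct (NP_in_space A L HL) as (M & k & H).
      refine (proj2 (in_space_NP_PSPACE _ A L M k _ HA H)); tauto.
    + destruct (PSPACE_in_space A L HL) as (M & k & H).
      refine (proj1 (in_space_NP_PSPACE _ A L M k _ HA H)); tauto.
  - intros [C [HC Hcomplete]]; destruct (Hdiag C HC) as (N & Hu & Hno).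
    apply Hno, Hcomplete, has_witness_UP, Hu.
Qed.
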